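(* Let $n\ge 1$, $T>0$. Assume the following. (1) $K\subseteq\mathbb{R}^n$ is a closed convex cone with vertex at the origin, $D\subset\mathbb{R}^n$ is a non-empty convex domain (open, connected) with $D\neq\mathbb{R}^n$, and either (a) $D$ is bounded and $K=\mathbb{R}^n$, or (b) $D$ is conic with vertex at the origin (i.e. $\lambda x\in D$ for all $x\in D$, $\lambda>0$) and $D-K:=\{\eta-\xi:\eta\in D,\ \xi\in K\}=\mathbb{R}^n$. (2) $f:[0,T]\times\mathbb{R}^n\to\mathbb{R}^n$ is continuous and for a constant $L>0$: $|f(t,x)-f(t,x')|\le L|x-x'|$ and $|f(t,0)|\le L$ for all $t\in[0,T]$, $x,x'\in\mathbb{R}^n$. (3) $g:[0,T]\times\mathbb{R}^n\to[0,\infty)$ and $h:\mathbb{R}^n\to[0,\infty)$ are continuous, and for constants $L,\mu>0$ and $0<\delta\le1$: $0\le g(t,x),h(x)\le L(1+|x|^{\mu+\delta})$ and $|g(t,x)-g(t,x')|,\ |h(x)-h(x')|\le L(1+|x|^\mu\vee|x'|^\mu)|x-x'|^\delta$ for all $t\in[0,T]$, $x,x'\in\mathbb{R}^n$. (4) $\ell:[0,T]\times\mathbb{R}^n\times K\to(0,\infty)$ is continuous, and there are constants $\ell_0,\delta_0>0$, $\beta\in(0,1]$, the same $L,\mu,\delta$ as in (3), and continuous decreasing functions $\alpha_0,\alpha:[0,T]\to(0,\infty)$ such that for all $t,t'\in[0,T]$, $x,x'\in\mathbb{R}^n$, $\xi,\xi'\in K$: $$\ell_0+\alpha_0(t)|\xi|^\beta\le\ell(t,x,\xi)\le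 L+\alpha(t)|\xi|^\beta,$$ $$|\ell(t,x,\xi)-\ell(t,x',\xi)|\le L(1+|x|^\mu\vee|x'|^\mu)|x-x'|^\delta,$$ $$\min\{\ell(t,x,\xi)+\ell(t,x+\xi,\xi'),\ \ell(t,x,\xi')+\ell(t,x+\xi',\xi)\}-\ell(t,x,\xi+\xi')\ge\delta_0,$$ $$\ell(t,x,\xi)-L|t-t'|\le\ell(t',x,\xi)\le\ell(t,x,\xi)\quad\text{if } t\le t'.$$ (5) $$\inf_{\xi\in K,\ x+\xi\in D}\big[h(x+\xi)+\ell(T,x,\xi)\big]<h(x)\qquad\text{for all }x\in\mathbb{R}^n\setminus D.$$ Let $V$ be the value function of the terminal-state-constrained impulse control problem described in the context, and let $\xi_0(\cdot)$ denote the trivial impulse control (no impulses). Then: (i) for all $(t,x)\in[0,T)\times\mathbb{R}^n$, $$V(t,x)\le\min_{\xi\in K}\{V(t,x+\xi)+\ell(t,x,\xi)\}=:\mathbf N[V](t,x);$$ (ii) for all $0\le t\le\hat t\le T$ and $x\in\mathbb{R}^n$, $$V(t,x)\le\int_t^{\hat t}g(r,X(r;t,x,\xi_0(\cdot)))\,dr+V(\hat t,X(\hat t;t,x,\xi_0(\cdot)));$$ (iii) if $(t,x)\in[0,T)\times\mathbb{R}^n$ and the inequality in (i) is strict at $(t,x)$, then there exists $\bar t\in(t,T]$ such that for all $\hat t\in[t,\bar t)$ $$V(t,x)=\int_t^{\hat t}g(r,X(r;t,x,\xi_0(\cdot)))\,dr+V(\hat t,X(\hat t;t,x,\xi_0(\cdot)));$$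 (iv) for all $x\in\mathbb{R}^n$, $$V(T,x)=h^D(x):=\begin{cases}\min\{h(x),\mathbf N^D[h](x)\},&x\in\bar D,\\ \mathbf N^D[h](x),&x\in\mathbb{R}^n\setminus\bar D,\end{cases}$$ where $\mathbf N^D[h](x)=\min_{\xi\in K,\ x+\xi\in\bar D}\{h(x+\xi)+\ell(T,x,\xi)\}$.
   Context: Impulse control problem. For $t\in[0,T]$, an impulse control on $[t,T]$ is a finite (possibly empty) list of pairs $(\tau_k,\xi_k)_{1\le k\le N}$ with $t\le\tau_1\le\dots\le\tau_N\le T$ and $\xi_k\in K$, identified with $\xi(s)=\sum_{k}\xi_k\mathbf 1_{[\tau_k,T]}(s)$, $s\in[t,T]$ (several impulses at one time are allowed, and zero impulses $\xi_k=0$ are allowed but still incur a cost). $\mathscr K[t,T]$ is the set of all of them. For $(t,x)\in[0,T]\times\mathbb{R}^n$ and $\xi(\cdot)\in\mathscr K[t,T]$, $X(\cdot)=X(\cdot;t,x,\xi(\cdot))$ is the unique (right-continuous) solution of $$X(s)=x+\int_t^sf(r,X(r))\,dr+\xi(s),\qquad s\in[t,T].$$ The set of admissible controls is $\mathscr K^x[t,T]=\{\xi(\cdot)\in\mathscr K[t,T]: X(T;t,x,\xi(\cdot))\in\bar D\}$. The cost functional is $$J(t,x;\xi(\cdot))=\int_t^Tg(s,X(s))\,ds+h(X(T))+\sum_{k}\ell(\tau_k,\tilde X(\tau_k-0),\xi_k),$$ where $\tilde X(\tau_k-0)$ is the state just before the $k$-th impulse is applied: the left limit $X(\tau_k-0)$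 (equal to $x$ if $\tau_k=t$) plus the sum of the impulses with smaller index made at the same time $\tau_k$. The value function is $V(t,x)=\inf_{\xi(\cdot)\in\mathscr K^x[t,T]}J(t,x;\xi(\cdot))$, with $\inf\varnothing=+\infty$. Notation: $a\vee b=\max\{a,b\}$. *)

(* Defs.v *)
From HB Require Import structures.
From mathcomp Require Import all_boot all_order all_algebra.
From mathcomp Require Import all_classical all_reals all_analysis.

Set Implicit Arguments.
Unset Strict Implicit.
Unset Printing Implicit Defensive.

Import Order.TTheory GRing.Theory Num.Theory.
Import numFieldNormedType.Exports.

Local Open Scope classical_set_scope.
Local Open Scope ring_scope.

(* The library norm on ['rV[R]_n] is the sup norm; the estimates on the data
   are stated with the Euclidean one (the topologies coincide). *)
Definition enorm (R : realType) (n : nat) (x : 'rV[R]_n) : R :=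
  Num.sqrt (\sum_(i < n) x ord0 i ^+ 2).

Definition conic (R : realType) (n : nat) (A : set 'rV[R]_n) : Prop :=
  forall (x : 'rV[R]_n) (c : R), A x -> 0 < c -> A (c *: x).

(* The list of pairs (tau_k, xi_k), in order of application. *)
Definition impulses (R : realType) (n : nat) : Type := seq (R * 'rV[R]_n).

Section Control.
Variables (R : realType) (n : nat).
Implicit Types (t s T : R) (x : 'rV[R]_n) (u : impulses R n).

Definition is_control (K : set 'rV[R]_n) T t u : Prop :=
  sorted <=%R [seq p.1 | p <- u] /\
  (forall p : R * 'rV[R]_n, p \in u -> t <= p.1 <= T /\ K p.2).

Definition control_path u s : 'rV[R]_n := \sum_(p <- u | p.1 <= s) p.2.

Definition is_trajectory (f : R -> 'rV[R]_n -> 'rV[R]_n) T t x u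
    (X : R -> 'rV[R]_n) : Prop :=
  [/\ forall s, t <= s < T -> X r @[r --> s^'+] --> X s,
      forall i : 'I_n, (@lebesgue_measure R).-integrable `[t, T]
        (fun r => (f r (X r) ord0 i)%:E) &
      forall s, t <= s <= T ->
        X s = x + \row_(i < n)
                    (\int[@lebesgue_measure R]_(r in `[t, s]) f r (X r) ord0 i)
                + control_path u s].

(* X( . ; t, x, u); only its values on [t, T] are meaningful. *)
Definition trajectory (f : R -> 'rV[R]_n -> 'rV[R]_n) T t x u :
    R -> 'rV[R]_n :=
  get [set X | is_trajectory f T t x u X].

(* The state just before the impulse of index [k] (counted from 0). *)
Definition pre_state t x u (X : R -> 'rV[R]_n) (k : nat) : 'rV[R]_n :=
  let tau (j : nat) := (nth (0, 0) u j).1 in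
  let xi (j : nat) := (nth (0, 0) u j).2 in
  (if tau k == t then x else lim (X r @[r --> (tau k)^'-]))
  + \sum_(j < k | tau j == tau k) xi j.

Definition cost (f : R -> 'rV[R]_n -> 'rV[R]_n)
    (g : R -> 'rV[R]_n -> R) (h : 'rV[R]_n -> R)
    (l : R -> 'rV[R]_n -> 'rV[R]_n -> R) T t x u : \bar R :=
  let X := trajectory f T t x u in
  (\int[@lebesgue_measure R]_(s in `[t, T]) (g s (X s))%:E
   + (h (X T))%:E
   + (\sum_(k < size u)
        l (nth (0, 0) u k).1 (pre_state t x u X k) (nth (0, 0) u k).2)%:E)%E.

Definition admissible (K D : set 'rV[R]_n)
    (f : R -> 'rV[R]_n -> 'rV[R]_n) T t x : set (impulses R n) :=
  [set u | is_control K T t u /\ closure D (trajectory f T t x u T)].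

Definition value (K D : set 'rV[R]_n) (f : R -> 'rV[R]_n -> 'rV[R]_n)
    (g : R -> 'rV[R]_n -> R) (h : 'rV[R]_n -> R)
    (l : R -> 'rV[R]_n -> 'rV[R]_n -> R) T t x : \bar R :=
  ereal_inf [set cost f g h l T t x u | u in admissible K D f T t x].

(* The operators N and N^D are minima: they are defined as infima of the
   following sets, and [attains_inf] says that the infimum is a minimum. *)
Definition attains_inf (S : set (\bar R)) : Prop := S (ereal_inf S).

Definition N_values (K : set 'rV[R]_n) (l : R -> 'rV[R]_n -> 'rV[R]_n -> R)
    (V : R -> 'rV[R]_n -> \bar R) t x : set (\bar R) :=
  [set (V t (x + xi)%R + (l t x xi)%:E)%E | xi in K].

Definition N_op K l V t x : \bar R := ereal_inf (N_values K l V t x).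

Definition ND_values (K D : set 'rV[R]_n)
    (l : R -> 'rV[R]_n -> 'rV[R]_n -> R) T (h : 'rV[R]_n -> R) x :
    set (\bar R) :=
  [set (h (x + xi) + l T x xi)%:E
    | xi in [set xi | K xi /\ closure D (x + xi)]].

Definition ND_op K D l T h x : \bar R := ereal_inf (ND_values K D l T h x).

Definition hD (K D : set 'rV[R]_n) (l : R -> 'rV[R]_n -> 'rV[R]_n -> R) T
    (h : 'rV[R]_n -> R) x : \bar R :=
  if `[< closure D x >] then Order.min (h x)%:E (ND_op K D l T h x)
  else ND_op K D l T h x.

End Control.

(* Main.v *)
(* The value function is an infimum that is attained. Splitting a trajectory at
   its first impulse [(tau, xi)] writes the cost as the running cost of the free
   motion up to [tau], plus the cost of that impulse, plus the cost of the
   remaining list started from the state just after it. Each of these terms is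
   continuous in the starting data, in [tau] and in [xi]; a bound on the cost
   bounds the number of impulses (each costs at least [l0]) and their sizes (the
   cost is coercive in [xi]). Hence a sequence of admissible controls with bounded
   cost converges along an ultrafilter to an admissible control whose cost is at
   most the limit of the costs, the terminal constraint being closed.
   Now (i) and (ii) follow by prepending to an optimal control one impulse,
   respectively a stretch of free motion. For (iii), an optimal control for
   [(t, x)] cannot act at time [t], since this would give
   [V(t, x) >= N[V](t, x)]; up to its first impulse time the motion is free, and
   there the dynamic programming equality holds. For (iv), impulses at time [T]
   merge into a single one by subadditivity of [l]. *)

Require Import Defs.
From HB Require Import structures.
From mathcomp Require Import all_boot all_order all_algebra.
From mathcomp Require Import all_classical all_reals all_analysis.
From mathcomp Require Import measurable_realfun ring lra.

Set Implicit Arguments.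
Unset Strict Implicit.
Unset Printing Implicit Defensive.

Import Order.TTheory GRing.Theory Num.Theory.
Import numFieldNormedType.Exports.

Local Open Scope classical_set_scope.
Local Open Scope ring_scope.

(** * The sup norm on row vectors and general facts on integrals *)

Lemma mx_norm_le (R : realType) (n : nat) (x : 'rV[R]_n) c : 0 <= c ->
  (`|x| <= c) = [forall i, `|x ord0 i| <= c].
Proof.
move=> c0; rewrite {1}/Num.norm /= mx_normrE; apply/idP/forallP.
  move=> /bigmax_leP[_ h] i; exact: (h (ord0, i)).
by move=> h; apply/bigmax_leP; split=> // -[i j] _ /=; rewrite (ord1 i).
Qed.

Lemma coord_le_mx_norm (R : realType) (n : nat) (x : 'rV[R]_n) i :
  `|x ord0 i| <= `|x|.
Proof. by have := lexx `|x|; rewrite {1}mx_norm_le// => /forallP. Qed.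

Lemma integrable_setU_disjoint d (T : measurableType d) (R : realType)
    (mu : {measure set T -> \bar R}) (A B : set T) (p : T -> R) :
  measurable A -> measurable B -> [disjoint A & B] ->
  mu.-integrable A (EFin \o p) -> mu.-integrable B (EFin \o p) ->
  mu.-integrable (A `|` B) (EFin \o p).
Proof.
move=> mA mB AB /integrableP[mpA iA] /integrableP[mpB iB].
have mp : measurable_fun (A `|` B) (EFin \o p) by apply/measurable_funU.
apply/integrableP; split => //.
rewrite ge0_integral_setU//; last exact: measurableT_comp.
by rewrite lte_add_pinfty.
Qed.

Lemma le_norm_Rintegral d (T : measurableType d) (R : realType)
    (mu : {measure set T -> \bar R}) (A : set T) (p q : T -> R) : measurable A ->
  mu.-integrable A (EFin \o p) -> mu.-integrable A (EFin \o q) ->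
  (forall r, A r -> `|p r| <= q r) ->
  `|\int[mu]_(r in A) p r| <= \int[mu]_(r in A) q r.
Proof.
move=> mA ip iq pq; rewrite (le_trans (le_normr_Rintegral mA ip))//.
by apply: le_Rintegral => //; exact: (integrable_norm ip).
Qed.

Lemma EFin_Rintegral d (T : measurableType d) (R : realType)
    (mu : {measure set T -> \bar R}) (A : set T) (p : T -> R) : measurable A ->
  mu.-integrable A (EFin \o p) ->
  (\int[mu]_(r in A) p r)%:E = (\int[mu]_(r in A) (p r)%:E)%E.
Proof.
by move=> mA ip; rewrite /Rintegral fineK//; exact: integrable_fin_num ip.
Qed.

(** * Scalar integrals over compact intervals *)

Section IntervalIntegrals.
Variable R : realType.
Notation mu := (@lebesgue_measure R).
Implicit Types (a b c s M : R) (p q : R -> R).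

Lemma integrable_cc p a b : continuous p -> mu.-integrable `[a, b] (EFin \o p).
Proof.
move=> cp; apply: continuous_compact_integrable; first exact: segment_compact.
exact: continuous_subspaceT.
Qed.

Lemma integrable_subitv p a b c d : a <= c -> d <= b ->
  mu.-integrable `[a, b] (EFin \o p) -> mu.-integrable `[c, d] (EFin \o p).
Proof.
move=> ac db; apply: integrableS => //.
by apply: subset_itv; rewrite bnd_simp.
Qed.

(** The left piece is half-open because a trajectory glued at a jump agrees with the free motion
    only strictly before the jump time. *)
Lemma integrable_itv_cat p a b c : a <= b -> b <= c ->
  mu.-integrable `[a, b[ (EFin \o p) -> mu.-integrable `[b, c] (EFin \o p) ->
  mu.-integrable `[a, c] (EFin \o p).
Proof.
move=> ab bc ip iq.
rewrite (@itv_bndbnd_setU _ _ _ (BLeft b)) ?bnd_simp//.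
apply: integrable_setU_disjoint => //.
apply/disj_setPS => y [/=]; rewrite 2!in_itv/= => /andP[_ yx] /andP[].
by rewrite leNgt yx.
Qed.

Lemma Rintegral_cc_lt p a b : b < a -> \int[mu]_(r in `[a, b]) p r = 0.
Proof. by move=> ba; rewrite set_itv_ge ?Rintegral_set0// bnd_simp -ltNge. Qed.

Lemma Rintegral_cc_le p a b : b <= a -> \int[mu]_(r in `[a, b]) p r = 0.
Proof.
rewrite le_eqVlt => /predU1P[->|]; last exact: Rintegral_cc_lt.
by rewrite set_itv1 Rintegral_set1.
Qed.

Lemma Rintegral_cc_cat p a b c : a <= b -> b <= c ->
  mu.-integrable `[a, c] (EFin \o p) ->
  \int[mu]_(r in `[a, c]) p r
  = \int[mu]_(r in `[a, b]) p r + \int[mu]_(r in `[b, c]) p r.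
Proof.
move=> ab bc ip; rewrite -(@Rintegral_itv_obnd_cbnd _ b (BRight c)); last first.
  by apply: integrableS ip => //; apply: subset_itv; rewrite bnd_simp.
rewrite -(@Rintegral_itvB _ _ (BLeft a) (BRight c) b)// ?bnd_simp//.
by rewrite addrC subrK.
Qed.

Lemma norm_Rintegral_le_cst p a b M : a <= b ->
  mu.-integrable `[a, b] (EFin \o p) ->
  (forall r, a <= r <= b -> `|p r| <= M) ->
  `|\int[mu]_(r in `[a, b]) p r| <= M * (b - a).
Proof.
move=> ab ip pM.
have -> : M * (b - a) = \int[mu]_(r in `[a, b]) (fun=> M) r.
  rewrite Rintegral_cst//= lebesgue_measure_itv/= lte_fin.
  by case: ltgtP ab => //= ->; rewrite subrr.
by apply: le_norm_Rintegral => //; apply: integrable_cc; exact: cst_continuous.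
Qed.

(** The position of [a] relative to [u] and [v] is left free: an integral whose right end lies
    before [a] vanishes, so only the part of [[u, v]] to the right of [a] contributes. *)
Lemma dist_Rintegral_le p a u v M : u <= v -> 0 <= M ->
  mu.-integrable `[a, v] (EFin \o p) ->
  (forall r, u <= r <= v -> `|p r| <= M) ->
  `|\int[mu]_(r in `[a, v]) p r - \int[mu]_(r in `[a, u]) p r| <= M * (v - u).
Proof.
move=> uv M0 ip pM; have [av|va] := leP a v; last first.
  rewrite !Rintegral_cc_lt ?subr0 ?normr0//; last exact: le_lt_trans va.
  by rewrite mulr_ge0// subr_ge0.
have [au|ua] := leP a u.
  rewrite (Rintegral_cc_cat au uv ip) addrC addKr norm_Rintegral_le_cst//.
  exact: integrable_subitv ip.
rewrite (Rintegral_cc_lt _ ua) subr0.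
apply: (le_trans (norm_Rintegral_le_cst av ip (M := M) _)).
  by move=> r /andP[ar rv]; rewrite pM// rv (ltW (lt_le_trans ua ar)).
by rewrite ler_wpM2l// lerB// ltW.
Qed.

(** Near [s] the integrand is bounded by [M = |p s| + 1], so the primitive is Lipschitz there with
    constant [M]. *)
Lemma continuous_Rintegral_cc p a : continuous p ->
  continuous (fun s => \int[mu]_(r in `[a, s]) p r).
Proof.
move=> cp s; apply/cvgrPdist_le => e e0.
pose M := `|p s| + 1.
have M0 : 0 < M by rewrite ltr_wpDl.
have /nbhs_ballP[d d0 sd] : \forall r \near s, `|p r| <= M.
  near=> r; rewrite -[p r](subrK (p s)) (le_trans (ler_normD _ _))// addrC.
  rewrite lerD2l distrC; near: r.
  by move/cvgrPdist_le : (cp s); apply.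
near=> r; have rs : `|s - r| < d by near: r; have := nbhsx_ballx s d d0.
have -> : e = M * (e / M) by rewrite mulrCA divff ?mulr1// gt_eqF.
have h u v w : u <= v -> `|s - u| < d -> `|s - v| < d -> u <= w <= v -> `|p w| <= M.
  move=> uv su sv /andP[uw wv]; apply: sd; rewrite /ball/=.
  move: su sv; rewrite !ltr_norml => /andP[? ?] /andP[? ?]; apply/andP; split; lra.
have dr : `|s - r| <= e / M.
  near: r; have /cvgrPdist_le := @cvg_id _ (nbhs s); apply; exact: divr_gt0.
have ss : `|s - s| < d by rewrite subrr normr0.
have [sr|rs'] := leP s r.
  rewrite distrC (le_trans (dist_Rintegral_le sr (ltW M0) _ _))//.
  - exact: integrable_cc.
  - by move=> w; apply: h.
  - by rewrite ler_pM2l// -(ger0_norm (_ : 0 <= r - s)) ?subr_ge0// distrC.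
rewrite (le_trans (dist_Rintegral_le (ltW rs') (ltW M0) _ _))//.
- exact: integrable_cc.
- by move=> w; apply: h => //; exact: ltW.
- by rewrite ler_pM2l// -(ger0_norm (_ : 0 <= s - r)) ?subr_ge0// ltW.
Unshelve. all: by end_near. Qed.

Lemma continuous_expR_affine k a : continuous (fun r : R => expR (k * (r - a))).
Proof.
move=> r; apply: (@continuous_comp _ _ _ (fun r : R => k * (r - a)) (@expR R)).
  by apply: cvgMr; apply: cvgB; [exact: cvg_id|exact: cvg_cst].
exact: continuous_expR.
Qed.

(** For [a < s] the fundamental theorem of calculus makes the left side equal to
    [expR (k * (s - a)) - 1]. *)
Lemma Rintegral_expR_le k a s : 0 < k -> a <= s ->
  k * (\int[mu]_(r in `[a, s]) expR (k * (r - a))) <= expR (k * (s - a)).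
Proof.
move=> k0; rewrite le_eqVlt => /predU1P[<-|as_].
  by rewrite Rintegral_cc_le// mulr0 expR_ge0.
rewrite -RintegralZl//; last exact/integrable_cc/continuous_expR_affine.
rewrite /Rintegral.
have dF (x : R) : is_derive x 1 (fun r => expR (k * (r - a)))
   (k * expR (k * (x - a))).
  have d1 : is_derive x 1 (fun r : R => k * (r - a)) k.
    by apply: is_derive_eq; rewrite subr0 /GRing.scale/= mulr1.
  have := @is_derive1_comp _ expR (fun r => k * (r - a)) x _ k (is_derive_expR _) d1.
  by rewrite mulrC.
rewrite (@continuous_FTC2 _ _ (fun r => expR (k * (r - a))))//=.
- by rewrite subrr mulr0 expR0 gerBl.
- apply: continuous_subspaceT => x.
  by apply: cvgMr; exact: continuous_expR_affine.
- split.
  + by move=> x _; apply: ex_derive.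
  + exact/cvg_at_right_filter/continuous_expR_affine.
  + exact/cvg_at_left_filter/continuous_expR_affine.
- by move=> x _; rewrite derive1E derive_val.
Qed.

(** Contraction estimate for the exponentially weighted sup norm (Bielecki norm): a Lipschitz factor
    [L] integrated against a weight of rate [2 * L] leaves the factor 1/2, whatever the length of
    the interval. *)
Lemma Rintegral_weighted_le L C p a s : 0 < L -> 0 <= C -> a <= s ->
  mu.-integrable `[a, s] (EFin \o p) ->
  (forall r, a <= r <= s -> `|p r| <= L * (C * expR (2 * L * (r - a)))) ->
  `|\int[mu]_(r in `[a, s]) p r| <= C / 2 * expR (2 * L * (s - a)).
Proof.
move=> L0 C0 as_ ip pC.
have cE := @continuous_expR_affine (2 * L) a.
have L20 : 0 < 2 * L by rewrite mulr_gt0.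
apply: (@le_trans _ _ (\int[mu]_(r in `[a, s]) (L * C * expR (2 * L * (r - a))))).
  apply: le_norm_Rintegral => //.
    by apply: integrable_cc => x; apply: cvgMr; exact: cE.
  by move=> r /=; rewrite in_itv/= -mulrA; exact: pC.
rewrite RintegralZl//; last exact: integrable_cc.
have -> : L * C = C / 2 * (2 * L) by field.
rewrite -[leLHS]mulrA; apply: (ler_wpM2l _ (Rintegral_expR_le L20 as_)).
exact: divr_ge0.
Qed.

End IntervalIntegrals.

(** * Componentwise integrals of vector-valued maps and a Gronwall estimate *)

Section VectorIntegrals.
Variables (R : realType) (n : nat).
Notation mu := (@lebesgue_measure R).
Implicit Types (a b c s : R) (U W : R -> 'rV[R]_n).

(** With [U r = f r (X r)] this is, up to conversion, the integral term of [is_trajectory]. *)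
Definition vint U a s : 'rV[R]_n :=
  \row_(i < n) (\int[mu]_(r in `[a, s]) U r ord0 i).

Definition vintegrable U a s : Prop :=
  forall i : 'I_n, mu.-integrable `[a, s] (fun r => (U r ord0 i)%:E).

Lemma cvg_rV (I : Type) (F : set_system I) (FF : Filter F)
    (x_ : I -> 'rV[R]_n) (x : 'rV[R]_n) :
  (forall i, x_ k ord0 i @[k --> F] --> x ord0 i) -> x_ k @[k --> F] --> x.
Proof.
move=> h; apply/cvgrPdist_le => e e0.
have : \forall k \near F, forall i, `|x ord0 i - x_ k ord0 i| <= e.
  by apply: filter_forall => i; move/cvgrPdist_le: (h i); apply.
apply: filterS => k hk; rewrite mx_norm_le ?ltW//; apply/forallP => i.
by rewrite !mxE.
Qed.

Lemma cvg_coord (I : Type) (F : set_system I) (FF : Filter F)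
    (x_ : I -> 'rV[R]_n) (x : 'rV[R]_n) i :
  x_ k @[k --> F] --> x -> x_ k ord0 i @[k --> F] --> x ord0 i.
Proof. exact: (continuous_cvg _ (@coord_continuous _ _ _ ord0 i x)). Qed.

Lemma vintegrable_cc U a s : continuous U -> vintegrable U a s.
Proof.
move=> cU i; apply: (@integrable_cc _ (fun r => U r ord0 i)) => r.
by apply: cvg_coord; exact: cU.
Qed.

Lemma vintegrable_subitv U a b c d : a <= c -> d <= b ->
  vintegrable U a b -> vintegrable U c d.
Proof. by move=> ac db iU i; exact: integrable_subitv (iU i). Qed.

Lemma vintegrableB U W a s : vintegrable U a s -> vintegrable W a s ->
  vintegrable (U \- W) a s.
Proof.
move=> iU iW i; apply: eq_integrable (integrableB _ (iU i) (iW i)) => // r _.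
by rewrite /= !mxE EFinB.
Qed.

Lemma vint_le U a b : b <= a -> vint U a b = 0.
Proof.
by move=> ba; apply/rowP => i; rewrite !mxE Rintegral_cc_le.
Qed.

Lemma vint_cat U a b c : a <= b -> b <= c -> vintegrable U a c ->
  vint U a c = vint U a b + vint U b c.
Proof.
move=> ab bc iU; apply/rowP => i; rewrite !mxE.
exact: (Rintegral_cc_cat ab bc (iU i)).
Qed.

Lemma eq_vint U W a s : (forall r, a <= r <= s -> U r = W r) ->
  vint U a s = vint W a s.
Proof.
move=> UW; apply/rowP => i; rewrite !mxE; apply: eq_Rintegral => r.
by rewrite inE/= in_itv/= => /UW ->.
Qed.

Lemma vintB U W a s : vintegrable U a s -> vintegrable W a s ->
  vint (U \- W) a s = vint U a s - vint W a s.
Proof.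
move=> iU iW; apply/rowP => i; rewrite !mxE -(RintegralB _ (iU i) (iW i))//.
by apply: eq_Rintegral => r _; rewrite !mxE.
Qed.

Lemma vint_weighted_le U L C a s : 0 < L -> 0 <= C -> a <= s ->
  vintegrable U a s ->
  (forall r, a <= r <= s -> `|U r| <= L * (C * expR (2 * L * (r - a)))) ->
  `|vint U a s| <= C / 2 * expR (2 * L * (s - a)).
Proof.
move=> L0 C0 as_ iU UC; rewrite mx_norm_le ?mulr_ge0 ?expR_ge0//.
apply/forallP => i; rewrite mxE.
apply: (Rintegral_weighted_le L0 C0 as_ (iU i)) => r rs.
exact: le_trans (coord_le_mx_norm _ _) (UC r rs).
Qed.

Lemma continuous_vint U a : continuous U -> continuous (vint U a).
Proof.
move=> cU s; apply: cvg_rV => i; under eq_fun do rewrite mxE; rewrite mxE.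
by apply: continuous_Rintegral_cc => r; apply: cvg_coord; exact: cU.
Qed.

Lemma div_exp2_near0 (C e : R) : 0 < e ->
  \forall k \near \oo, C / 2 ^+ k <= e.
Proof.
move=> e0; have h2 : `|2^-1 : R| < 1 by rewrite ger0_norm// invf_lt1// ltr1n.
have /cvgrPdist_le/(_ e e0) := cvg_geometric C h2.
apply: filterS => k.
by rewrite sub0r normrN /geometric/= exprVn => /(le_trans (ler_norm _)).
Qed.

(* The exponential weight makes the map [Z |-> vint P] a contraction with
   factor [1/2]. *)
Lemma gronwall L d a b (Z P : R -> 'rV[R]_n) : 0 < L -> 0 <= d ->
  vintegrable P a b ->
  (forall r, a <= r <= b -> `|P r| <= L * `|Z r|) ->
  (forall s, a <= s <= b -> `|Z s - vint P a s| <= d) ->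
  forall s, a <= s <= b -> `|Z s| <= 2 * d * expR (2 * L * (s - a)).
Proof.
move=> L0 d0 iP PZ Zd s sab.
have ge1 r : a <= r -> 1 <= expR (2 * L * (r - a)).
  by move=> ar; rewrite -expR0 ler_expR !mulr_ge0 ?subr_ge0// ltW.
(* [C0] is a crude bound of [|Z|] on [[a, b]]. Only its finiteness matters, since its contribution
   is halved at each round below. *)
pose C0 := d + \sum_i \int[mu]_(r in `[a, b]) `|P r ord0 i|.
have S0 : 0 <= \sum_i \int[mu]_(r in `[a, b]) `|P r ord0 i|.
  by apply: sumr_ge0 => i _; exact: Rintegral_ge0.
have C00 : 0 <= C0 by exact: addr_ge0.
(* A bound [c] on the weighted norm of [Z] improves to [d + c / 2], whose fixed point is [2 * d];
   from the start [2 * d + C0], the excess after [k] rounds is [C0 / 2 ^+ k]. *)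
have step k r : a <= r <= b ->
    `|Z r| <= (2 * d + C0 / 2 ^+ k) * expR (2 * L * (r - a)).
  elim: k r => [|k IH] r /[dup] rab /andP[ar rb].
    rewrite expr0 divr1 -[leLHS]mulr1 ler_pM ?ge1//.
    rewrite -[Z r](subrK (vint P a r)) (le_trans (ler_normD _ _))//.
    apply: (@le_trans _ _ C0); last by rewrite lerDr mulr_ge0.
    rewrite lerD ?Zd// mx_norm_le//; apply/forallP => i; rewrite mxE.
    rewrite (bigD1 i)//= -[leLHS]addr0 lerD//; last first.
      by apply: sumr_ge0 => j _; exact: Rintegral_ge0.
    have iPr : vintegrable P a r by exact: vintegrable_subitv iP.
    rewrite (le_trans (le_normr_Rintegral _ (iPr i)))//.
    rewrite (Rintegral_cc_cat ar rb); last exact: integrable_norm (iP i).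
    by rewrite lerDl Rintegral_ge0.
  have Ck : 0 <= 2 * d + C0 / 2 ^+ k by rewrite addr_ge0 ?mulr_ge0 ?invr_ge0.
  rewrite -[Z r](subrK (vint P a r)) (le_trans (ler_normD _ _))//.
  have -> : 2 * d + C0 / 2 ^+ k.+1 = d + (2 * d + C0 / 2 ^+ k) / 2.
    by rewrite exprS; field; rewrite expf_neq0.
  rewrite mulrDl lerD//.
    by rewrite (le_trans (Zd r rab))// -[leLHS]mulr1 ler_wpM2l ?ge1.
  apply: vint_weighted_le => //; first exact: vintegrable_subitv iP.
  move=> u /andP[au ur]; have uab : a <= u <= b by rewrite au (le_trans ur).
  by rewrite (le_trans (PZ _ uab))// ler_pM2l// IH.
apply/ler_addgt0Pr => e e0.
have es0 : 0 < e / expR (2 * L * (s - a)) by rewrite divr_gt0 ?expR_gt0.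
have [k _ /(_ k (leqnn _)) /= ke] := div_exp2_near0 C0 es0.
rewrite (le_trans (step k s sab))// mulrDl lerD2l.
by rewrite -ler_pdivlMr ?expR_gt0.
Qed.

End VectorIntegrals.

(** * The flow of a Lipschitz vector field *)

Section Flow.
Variables (R : realType) (n : nat).
Notation mu := (@lebesgue_measure R).
Variables (F : R -> 'rV[R]_n -> 'rV[R]_n) (L B : R).
Hypothesis F_cont : continuous (fun p : R * 'rV[R]_n => F p.1 p.2).
Hypothesis L_gt0 : 0 < L.
Hypothesis F_lip : forall r x y, `|F r x - F r y| <= L * `|x - y|.
Hypothesis F_bnd : forall r, `|F r 0| <= B.
Implicit Types (a b t s r : R) (x y : 'rV[R]_n) (X Y : R -> 'rV[R]_n).

Local Notation vel X := (fun r : R => F r (X r)).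
Local Notation w t s := (expR (2 * L * (s - t))).

Lemma continuous_velocity X : continuous X -> continuous (fun r => F r (X r)).
Proof.
by move=> cX r; exact: cvg_comp2 cvg_id (cX r) (@F_cont (r, X r)).
Qed.

Fixpoint picard t x (k : nat) : R -> 'rV[R]_n :=
  if k is k'.+1 then fun s => x + vint (vel (picard t x k')) t s else fun=> x.

Lemma continuous_picard t x k : continuous (picard t x k).
Proof.
elim: k => [|k IH] s /=; first exact: cvg_cst.
apply: cvgD; first exact: cvg_cst.
exact/continuous_vint/continuous_velocity.
Qed.

Let w_gt0 t s : 0 < w t s. Proof. exact: expR_gt0. Qed.
Let w_ge0 t s : 0 <= w t s. Proof. exact: expR_ge0. Qed.

Definition picard_cst x : R := (B + L * `|x|) / L.

Lemma picard_cst_ge0 x : 0 <= picard_cst x.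
Proof.
have B0 : 0 <= B by exact: le_trans (F_bnd 0).
by rewrite divr_ge0 ?addr_ge0 ?mulr_ge0// ltW.
Qed.

Let dist_cst_ge0 x k : 0 <= 2 * picard_cst x / 2 ^+ k.
Proof.
apply: divr_ge0; last exact: exprn_ge0.
by apply: mulr_ge0; last exact: picard_cst_ge0.
Qed.

Lemma vint_lip X Y C t s : continuous X -> continuous Y -> 0 <= C -> t <= s ->
  (forall r, t <= r <= s -> `|X r - Y r| <= C * w t r) ->
  `|vint (vel X) t s - vint (vel Y) t s| <= C / 2 * w t s.
Proof.
move=> cX cY C0 ts XY; rewrite -vintB//; try exact/vintegrable_cc/continuous_velocity.
apply: vint_weighted_le => //.
  by apply: vintegrableB; exact/vintegrable_cc/continuous_velocity.
by move=> r rs; rewrite (le_trans (F_lip _ _ _))// ler_pM2l// XY.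
Qed.

(** For [s <= t] both iterates equal [x]; beyond [t], each further application of the integral
    operator halves the weighted distance, by [vint_lip]. *)
Lemma picard_step t x k s :
  `|picard t x k.+1 s - picard t x k s| <= picard_cst x / 2 ^+ k * w t s.
Proof.
have C0 := picard_cst_ge0 x.
have [st|ts] := leP s t.
  case: k => [|k] /=; rewrite !vint_le// !addr0 subrr normr0;
  by rewrite mulr_ge0// divr_ge0// exprn_ge0.
elim: k s ts => [|k IH] s ts.
  rewrite expr0 divr1 /= addrC addKr.
  apply: (@le_trans _ _ (picard_cst x / 2 * w t s)).
    apply: vint_weighted_le => //; first exact: ltW.
      exact/vintegrable_cc/continuous_velocity/cst_continuous.
    move=> r /andP[tr _]; rewrite -[F r x](subrK (F r 0)).
    rewrite (le_trans (ler_normD _ _))//.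
    apply: (@le_trans _ _ (L * picard_cst x)).
      rewrite /picard_cst mulrC divfK ?gt_eqF// addrC lerD// -{2}[x]subr0.
      exact: F_lip.
    rewrite ler_pM2l// -[leLHS]mulr1 ler_wpM2l//.
    by rewrite -expR0 ler_expR mulr_ge0 ?subr_ge0// mulr_ge0// ltW.
  by rewrite ler_pM2r// ler_pdivrMr// ler_peMr// ler1n.
rewrite [X in _ <= X](_ : _ = (picard_cst x / 2 ^+ k) / 2 * w t s); last first.
  by rewrite exprSr invfM mulrA.
have -> : picard t x k.+2 s - picard t x k.+1 s =
    vint (vel (picard t x k.+1)) t s - vint (vel (picard t x k)) t s.
  by rewrite [LHS]/= opprD addrACA subrr add0r.
apply: vint_lip; [exact: continuous_picard|exact: continuous_picard| |exact: ltW|].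
  by rewrite divr_ge0// exprn_ge0.
move=> r /andP[]; rewrite le_eqVlt => /predU1P[<- _|tr _]; last exact: IH.
case: k {IH} => [|k] /=; rewrite !vint_le// !addr0 subrr normr0;
by rewrite mulr_ge0// divr_ge0// exprn_ge0.
Qed.

Lemma picard_dist t x k m s : `|picard t x (k + m) s - picard t x k s|
  <= 2 * picard_cst x / 2 ^+ k * w t s.
Proof.
(* The induction on [m] carries the exact partial sum of the geometric series; its subtracted term
   is dropped to get the claim. *)
suff : `|picard t x (k + m) s - picard t x k s|
    <= 2 * picard_cst x * (1 / 2 ^+ k - 1 / 2 ^+ (k + m)) * w t s.
  move=> /le_trans; apply; move: (picard_cst x) (picard_cst_ge0 x) => c c0.
  rewrite ler_pM2r// -!mulrA ler_wpM2l// ler_wpM2l// div1r gerBl.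
  by rewrite divr_ge0// exprn_ge0.
elim: m => [|m IH]; first by rewrite addn0 !subrr normr0 mulr0 mul0r.
rewrite addnS -[_ - _](subrKA (picard t x (k + m) s)) (le_trans (ler_normD _ _))//.
have := lerD (picard_step t x (k + m) s) IH => /le_trans; apply.
rewrite -mulrDl ler_pM2r// exprS.
rewrite [leLHS](_ : _ = 2 * picard_cst x * (1 / 2 ^+ k - 1 / (2 * 2 ^+ (k + m))))//.
by field; rewrite !expf_neq0.
Qed.

(* Integrals over [`[t, s]] vanish for [s <= t], so the flow started at time [t]
   is constant before [t]. *)
Definition flow t x s : 'rV[R]_n := lim (picard t x k s @[k --> \oo]).

Lemma picard_cvg t x s : picard t x k s @[k --> \oo] --> flow t x s.
Proof.
suff : cvg (picard t x k s @[k --> \oo]) by [].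
apply/cauchy_cvgP/cauchy_exP => e e0.
have es0 : 0 < e / 2 / w t s by rewrite !divr_gt0.
have [k _ /(_ k (leqnn _)) /= ke] := div_exp2_near0 (2 * picard_cst x) es0.
exists (picard t x k s); exists k => // j /= kj; rewrite mx_norm_ball /ball_/= distrC.
rewrite -(subnKC kj) (le_lt_trans (picard_dist _ _ _ _ _))//.
apply: (@le_lt_trans _ _ (e / 2)); first by rewrite -ler_pdivlMr.
by rewrite ltr_pdivrMr// ltr_pMr// ltr1n.
Qed.

Lemma flow_picard_dist t x k s : `|flow t x s - picard t x k s|
  <= 2 * picard_cst x / 2 ^+ k * w t s.
Proof.
apply/ler_addgt0Pr => e e0.
have /cvgrPdist_le/(_ e e0) [m _ /(_ (k + m)%N (leq_addl _ _)) h] := @picard_cvg t x s.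
rewrite -[_ - _](subrKA (picard t x (k + m) s)) (le_trans (ler_normD _ _))//.
by rewrite addrC lerD// picard_dist.
Qed.

(** The iterates are continuous and converge uniformly before time [s + 1], where the weight is at
    most [w t (s + 1)]. *)
Lemma continuous_flow t x : continuous (flow t x).
Proof.
move=> s; apply/cvgrPdist_le => e e0.
have e30 : 0 < e / 3 by rewrite divr_gt0.
have es0 : 0 < e / 3 / w t (s + 1) by rewrite !divr_gt0.
have [k _ /(_ k (leqnn _)) /= ke] := div_exp2_near0 (2 * picard_cst x) es0.
have close r : r < s + 1 -> `|flow t x r - picard t x k r| <= e / 3.
  move=> rs; rewrite (le_trans (flow_picard_dist _ _ k _))//.
  rewrite ler_pdivlMr// in ke; rewrite (le_trans _ ke)// ler_wpM2l//.
  by rewrite ler_expR ler_pM2l ?mulr_gt0// lerB// ltW.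
near=> r.
have rs : r < s + 1 by near: r; apply: lt_nbhsl; rewrite ltrDl.
have sr : `|picard t x k s - picard t x k r| <= e / 3.
  near: r; have /cvgrPdist_le := @continuous_picard t x k s; exact.
have ss := close s; have := close r rs.
rewrite distrC => h1; have {}ss := ss _.
rewrite -[_ - _](subrKA (picard t x k s)) (le_trans (ler_normD _ _))//.
rewrite -[picard t x k s - _](subrKA (picard t x k r)).
have -> : e = e / 3 + (e / 3 + e / 3) by field.
by rewrite lerD ?ss ?ltrDl// (le_trans (ler_normD _ _))// lerD.
Unshelve. all: by end_near. Qed.

(** Both sides are close to [picard t x k.+1]: the left one by convergence, the right one because
    the integral operator halves the weighted distance between the flow and [picard t x k]. *)
Lemma flowE t x s :
  flow t x s = x + vint (vel (flow t x)) t s.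
Proof.
have cX := @continuous_flow t x.
apply/eqP; rewrite -subr_eq0 -normr_le0; apply/ler_addgt0Pr => e e0; rewrite add0r.
have es0 : 0 < e / 2 / w t s by rewrite !divr_gt0.
have [k _ /(_ k (leqnn _)) /= ke] := div_exp2_near0 (2 * picard_cst x) es0.
rewrite -[_ - _](subrKA (picard t x k.+1 s)) (le_trans (ler_normD _ _))//.
have -> : e = e / 2 + e / 2 by field.
rewrite ler_pdivlMr// in ke; apply: lerD.
  apply: le_trans (flow_picard_dist _ _ _ _) _.
  apply: le_trans ke; rewrite ler_pM2r// exprSr invfM mulrA.
  by rewrite ler_piMr// invf_le1// ler1n.
rewrite /= opprD addrACA subrr add0r.
have [st|ts] := leP s t; first by rewrite !vint_le// subr0 normr0 divr_ge0// ltW.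
apply: (@le_trans _ _ (2 * picard_cst x / 2 ^+ k / 2 * w t s)).
  apply: vint_lip => //; [exact: continuous_picard|exact: ltW|].
  by move=> r _; rewrite distrC flow_picard_dist.
apply: le_trans ke; rewrite ler_pM2r//.
by rewrite ler_pdivrMr// ler_peMr// ler1n.
Qed.

(** Gronwall with defect 0 applied to [X \- Y]. The common term [c] is a constant for the semigroup
    law, and the starting point plus [control_path] for controlled trajectories. *)
Lemma velocity_unique (c : R -> 'rV[R]_n) X Y t s :
  vintegrable (vel X) t s -> vintegrable (vel Y) t s ->
  (forall r, t <= r <= s -> X r = c r + vint (vel X) t r) ->
  (forall r, t <= r <= s -> Y r = c r + vint (vel Y) t r) ->
  forall r, t <= r <= s -> X r = Y r.
Proof.
move=> iX iY XE YE r rs; apply/eqP; rewrite -subr_eq0 -normr_le0.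
have G := @gronwall _ _ L 0 t s (X \- Y) (vel X \- vel Y) L_gt0 (lexx _).
apply: (@le_trans _ _ (2 * 0 * w t r)); last by rewrite mulr0 mul0r.
apply: G => //; first exact: vintegrableB.
- by move=> u us; exact: F_lip.
- move=> u /[dup] us /andP[tu us']; rewrite vintB ?normr_le0.
  + by rewrite /= XE// YE// opprD addrACA subrr add0r subrr.
  + exact: vintegrable_subitv iX.
  + exact: vintegrable_subitv iY.
Qed.

Lemma flow_id t x s : s <= t -> flow t x s = x.
Proof. by move=> st; rewrite flowE vint_le// addr0. Qed.

Let vintegrable_flow t x a b : vintegrable (vel (flow t x)) a b.
Proof. exact/vintegrable_cc/continuous_velocity/continuous_flow. Qed.

Lemma flow_semigroup t x a s : t <= a -> a <= s ->
  flow t x s = flow a (flow t x a) s.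
Proof.
move=> ta as_; apply: (@velocity_unique (fun=> flow t x a) _ _ a s) => //.
- move=> r /andP[ar _]; rewrite {1}flowE [in RHS]flowE.
  by rewrite (vint_cat ta ar)// addrA.
- by move=> r _; exact: flowE.
- by rewrite as_ lexx.
Qed.

(** Joint continuous dependence on the starting time and point, uniform up to time [b]. The
    difference of the two flows obeys the Gronwall estimate with a defect made of [x - x_ i] and of
    the velocity integrated between [t] and [t_ i]. *)
Lemma flow_near_uniform (I : Type) (Fl : set_system I) (FFl : Filter Fl)
    (t_ : I -> R) (x_ : I -> 'rV[R]_n) t x b :
  t_ i @[i --> Fl] --> t -> x_ i @[i --> Fl] --> x ->
  forall e, 0 < e -> \forall i \near Fl, forall r, t_ i <= r <= b ->
    `|flow (t_ i) (x_ i) r - flow t x r| <= e.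
Proof.
move=> tt xx e e0; set X := flow t x.
(* Starting the primitive at [t - 1], eventually before [t_ i], writes the integrals from [t_ i] as
   differences of [J] whether [t_ i] lies before or after [t]. *)
pose J := vint (vel X) (t - 1).
have cJ : continuous J.
  exact/continuous_vint/continuous_velocity/continuous_flow.
pose E := expR (2 * L * (b - (t - 1))).
have E0 : 0 < E by exact: expR_gt0.
(* The defect will be at most [3 * d], and Gronwall multiplies it by at most [2 * E]. *)
pose d := e / 2 / E / 3.
have d0 : 0 < d by rewrite !divr_gt0.
have [q q0 Jq] : exists2 q, 0 < q & forall r, `|t - r| < q -> `|J t - J r| <= d.
  have /cvgrPdist_le/(_ d d0)/nbhs_ballP[q q0 h] := cJ t.
  by exists q => // r; exact: h.
near=> i => s /andP[ts sb].
have tq : `|t - t_ i| < q.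
  by near: i; move/cvgrPdist_lt : tt; apply.
have t1 : `|t - t_ i| < 1.
  by near: i; move/cvgrPdist_lt : tt; apply.
have xd : `|x - x_ i| <= d.
  by near: i; move/cvgrPdist_le : xx; apply.
have ti : t - 1 <= t_ i.
  by rewrite lerBlDr -lerBlDl ltW// (le_lt_trans (ler_norm _) t1).
have JB u v : t - 1 <= u -> u <= v -> vint (vel X) u v = J v - J u.
  move=> tu uv; rewrite /J (vint_cat tu uv); first by rewrite addrC addKr.
  exact: vintegrable_flow.
have Xd r : t_ i <= r -> `|X r - x - vint (vel X) (t_ i) r| <= d + d.
  move=> tr; rewrite {1}/X flowE -/X [x + _]addrC addrK (JB (t_ i) r)//.
  have tt1 : t - 1 <= t by rewrite gerBl.
  have [tr'|rt] := leP t r.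
    rewrite JB// (_ : J r - J t - (J r - J (t_ i)) = - (J t - J (t_ i))).
      by rewrite normrN (le_trans (Jq _ tq))// lerDl ltW.
    by apply/rowP => j; move: (J r) (J t) (J (t_ i)) => *; rewrite !mxE; ring.
  (* For [t_ i <= r < t] the flow [X] has not left [x], so the whole integral from [t_ i] to [r] is
     defect; it is bounded by passing through [J t], whence the second [d]. *)
  rewrite vint_le ?(ltW rt)// sub0r normrN -[J r - _](subrKA (J t)).
  rewrite (le_trans (ler_normD _ _))// lerD//; last exact: Jq.
  rewrite distrC Jq//; apply: le_lt_trans tq.
  by rewrite !ger0_norm ?subr_ge0 ?(le_trans tr (ltW rt)) ?(ltW rt)// lerB.
have := @gronwall _ _ L (3 * d) (t_ i) b (flow (t_ i) (x_ i) \- X)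
  (vel (flow (t_ i) (x_ i)) \- vel X) L_gt0.
move=> /(_ _ _ _ _ s) G.
apply: (@le_trans _ _ (2 * (3 * d) * expR (2 * L * (s - t_ i)))).
  apply: G; rewrite ?ts ?sb//.
  - by rewrite mulr_ge0 ?ltW.
  - by apply: vintegrableB; exact: vintegrable_flow.
  - by move=> r _; exact: F_lip.
  - move=> r /andP[tr _]; rewrite vintB; try exact: vintegrable_flow.
    rewrite /= {1}flowE.
    rewrite [X in `|X|](_ : _ =
      - (X r - x - vint (vel X) (t_ i) r) - (x - x_ i)).
      rewrite (le_trans (ler_normB _ _))// normrN.
      have -> : 3 * d = (d + d) + d by ring.
      by rewrite lerD// Xd.
    apply/rowP => j; move: (vint _ _ _) (vint _ _ _) (X r) => *.
    by rewrite !mxE; ring.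
have -> : e = 2 * (3 * d) * E by rewrite /d; field; rewrite gt_eqF.
have d6 : 0 < 2 * (3 * d) by apply: mulr_gt0 => //; exact: mulr_gt0.
by rewrite (ler_pM2l d6) ler_expR ler_pM2l ?mulr_gt0// lerB.
Unshelve. all: by end_near. Qed.

End Flow.

(** * Limits along filters and ultrafilters, and compactness *)

Lemma le_cvgr (I : Type) (Fl : set_system I) {FF : ProperFilter Fl}
    (R : realFieldType) (a_ b_ : I -> R) (a b : R) :
  a_ i @[i --> Fl] --> a -> b_ i @[i --> Fl] --> b ->
  (\forall i \near Fl, a_ i <= b_ i) -> a <= b.
Proof.
move=> ha hb ab; rewrite -subr_ge0; apply: (cvgr_to_ge (cvgB hb ha)).
by apply: filterS ab => i; rewrite -subr_ge0.
Qed.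

Lemma cvg_pair_nbhs (I : Type) (U V : topologicalType) (Fl : set_system I)
    (FF : Filter Fl) (a_ : I -> U) (b_ : I -> V) (a : U) (b : V) :
  a_ i @[i --> Fl] --> a -> b_ i @[i --> Fl] --> b ->
  (a_ i, b_ i) @[i --> Fl] --> ((a, b) : U * V).
Proof. by move=> ha hb; exact: (cvg_pair ha hb). Qed.

Lemma cvg_within_comp (I : Type) (U : topologicalType)
    (Y : topologicalType) (Fl : set_system I) (FF : Filter Fl)
    (A : set U) (phi : U -> Y) (x_ : I -> U) (x : U) :
  {within A, continuous phi} -> A x -> (\forall i \near Fl, A (x_ i)) ->
  x_ i @[i --> Fl] --> x -> phi (x_ i) @[i --> Fl] --> phi x.
Proof.
move=> /subspace_continuousP cphi Ax Ax_ xx; apply: cvg_comp (cphi x Ax).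
move=> P xP; have Fl2 := xx _ xP.
by apply: filterS2 Ax_ Fl2 => i Ai; apply.
Qed.

(** Maximality: if a finer proper filter contained a set whose preimage is not in [Fl], the preimage
    of the complement would be in [Fl], and the finer filter would contain both the set and its
    complement. *)
Lemma ultra_fmap (I J : Type) (Fl : set_system I) (phi : I -> J) :
  UltraFilter Fl -> UltraFilter (phi @ Fl).
Proof.
move=> FU; have FP := @ultra_proper _ _ FU.
split; first exact: fmap_proper_filter.
move=> G GP sub; apply/seteqP; split=> A; last exact: sub.
move=> GA; have [//|FnA] := in_ultra_setVsetC (phi @^-1` A) FU.
have GnA : G (~` A) by apply: sub.
have : G set0 by rewrite -(setICr A); exact: filterI.
by move/filter_not_empty.
Qed.

(** Along one fixed ultrafilter every bounded component of a control converges, so no successive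
    extraction of subsequences is required. *)
Lemma compact_ultra_cvg (I : Type) (U : topologicalType) (Fl : set_system I)
    (A : set U) (y_ : I -> U) : UltraFilter Fl -> compact A ->
  (\forall i \near Fl, A (y_ i)) -> exists2 y, A y & y_ i @[i --> Fl] --> y.
Proof.
move=> FU cA Ay; move: cA; rewrite compact_ultra => cA.
by have [y [? ?]] := cA _ (ultra_fmap y_ FU) Ay; exists y.
Qed.

Lemma closed_ball0_compact (R : realType) (n : nat) (rho : R) :
  compact [set xi : 'rV[R]_n | `|xi| <= rho].
Proof.
apply: bounded_closed_compact.
  exists rho; split; first exact: num_real.
  by move=> M rM x /= /le_trans; apply; exact: ltW.
have -> : [set xi : 'rV[R]_n | `|xi| <= rho] =
    (fun xi : 'rV[R]_n => `|xi|) @^-1` [set r | r <= rho] by [].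
by apply: closed_comp; [move=> x _; exact: norm_continuous|exact: closed_le].
Qed.

(** * Projection of times onto [[0, T]] *)

Section Clamp.
Variables (R : realType) (T : R).
Hypothesis T_ge0 : 0 <= T.

Definition clamp (r : R) : R := Num.max 0 (Num.min r T).

Lemma clamp_itv r : 0 <= clamp r <= T.
Proof. by rewrite /clamp le_max lexx /= ge_max T_ge0 ge_min lexx orbT. Qed.

Lemma clamp_id r : 0 <= r <= T -> clamp r = r.
Proof. by move=> /andP[r0 rT]; rewrite /clamp min_l// max_r. Qed.

Lemma continuous_clamp : continuous clamp.
Proof.
move=> r; rewrite /clamp.
apply: (@continuous_max _ _ (fun=> 0) (fun r => Num.min r T)).
  exact: cvg_cst.
by apply: (@continuous_min _ _ id (fun=> T)); [exact: cvg_id|exact: cvg_cst].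
Qed.

End Clamp.

(** * Impulse controls as sorted lists *)

Section ControlLists.
Variables (R : realType) (n : nat) (K : set 'rV[R]_n) (T : R).
Implicit Types (t s : R) (u : impulses R n) (p : R * 'rV[R]_n).

Lemma is_control_nil t : is_control K T t [::].
Proof. by split. Qed.

(** Sortedness makes the tail a control started at the first impulse time; this is the form in which
    every induction on controls proceeds. *)
Lemma is_control_cons t p u : is_control K T t (p :: u) <->
  [/\ t <= p.1 <= T, K p.2 & is_control K T p.1 u].
Proof.
split=> [[/= pu Ku]|[tp Kp [su Ku]]].
  have [tp Kp] := Ku p (mem_head _ _); split => //; split.
    exact: path_sorted pu.
  move=> q qu; have [tq Kq] := Ku q (@mem_behead _ (p :: u) _ qu).
  split=> //; case/andP: tq => _ ->; rewrite andbT.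
  have /allP := order_path_min le_trans pu; apply.
  by apply/mapP; exists q.
split=> [/=|q]; last first.
  rewrite inE => /predU1P[->//|/Ku[/andP[pq ->] Kq]].
  by rewrite andbT; split=> //; case/andP: tp => /le_trans -> .
rewrite path_min_sorted//; apply/allP => _ /mapP[q qu ->].
by have [/andP[]] := Ku q qu.
Qed.

Lemma is_control_le t t' u : t' <= t -> is_control K T t u ->
  is_control K T t' u.
Proof.
move=> tt' [su Ku]; split=> // p /Ku[/andP[tp pT] Kp].
by rewrite pT andbT (le_trans tt').
Qed.

Lemma control_path_cons p u s :
  control_path (p :: u) s = (if p.1 <= s then p.2 else 0) + control_path u s.
Proof. by rewrite /control_path big_cons; case: ifP; rewrite ?add0r. Qed.

Lemma control_path_before t u s : is_control K T t u -> s < t ->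
  control_path u s = 0.
Proof.
move=> [_ Ku] st; rewrite /control_path big_seq_cond big1// => p.
move=> /andP[/Ku[/andP[tp _] _] ps].
by have := lt_le_trans st (le_trans tp ps); rewrite ltxx.
Qed.

End ControlLists.

(** The right end point is Lebesgue-negligible, which absorbs the jump of a glued trajectory at that
    point. *)
Lemma eq_vint_co (R : realType) (n : nat) (U W : R -> 'rV[R]_n) (a b : R) :
  vintegrable U a b -> vintegrable W a b ->
  (forall r, a <= r < b -> U r = W r) -> vint U a b = vint W a b.
Proof.
move=> iU iW UW; apply/rowP => i; rewrite !mxE.
have s : `[a, b[%classic `<=` `[a, b]%classic by apply: subset_itv; rewrite bnd_simp.
rewrite -!Rintegral_itv_bndo_bndc; first last.
- by apply: integrableS (iU i).
- by apply: integrableS (iW i).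
by apply: eq_Rintegral => r; rewrite inE/= in_itv/= => /UW ->.
Qed.

(** * Controlled trajectories *)

Section ImpulseControl.
Variables (R : realType) (n : nat) (K : set 'rV[R]_n) (T : R).
Variables (f : R -> 'rV[R]_n -> 'rV[R]_n) (L B : R).
Hypothesis T_ge0 : 0 <= T.
Hypothesis f_cont : {within `[0, T] `*` [set: 'rV[R]_n],
  continuous (fun p : R * 'rV[R]_n => f p.1 p.2)}.
Hypothesis L_gt0 : 0 < L.
Hypothesis f_lip : forall r x y, 0 <= r <= T ->
  `|f r x - f r y| <= L * `|x - y|.
Hypothesis f_bnd : forall r, 0 <= r <= T -> `|f r 0| <= B.
Notation mu := (@lebesgue_measure R).
Implicit Types (t s tau : R) (x xi : 'rV[R]_n) (u : impulses R n).
Implicit Types (X : R -> 'rV[R]_n).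

(* The data are only controlled on [[0, T]]; freezing them outside makes the
   vector field continuous and Lipschitz for all times. *)
Definition cfield r x := f (clamp T r) x.

Lemma cfield_cont : continuous (fun p : R * 'rV[R]_n => cfield p.1 p.2).
Proof.
move=> p; apply: (@cvg_within_comp _ _ _ _ _ _
  (fun p : R * 'rV[R]_n => f p.1 p.2) (fun q : R * 'rV[R]_n => (clamp T q.1, q.2))
  (clamp T p.1, p.2) f_cont).
- by split=> //=; rewrite in_itv/= clamp_itv.
- by apply: nearW => q; split=> //=; rewrite in_itv/= clamp_itv.
- apply: cvg_pair_nbhs; last exact: cvg_snd.
  by apply: continuous_cvg; [exact: continuous_clamp|exact: cvg_fst].
Qed.

Lemma cfield_lip r x y : `|cfield r x - cfield r y| <= L * `|x - y|.
Proof. by apply: f_lip; exact: clamp_itv. Qed.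

Lemma cfield_bnd r : `|cfield r 0| <= B.
Proof. by apply: f_bnd; exact: clamp_itv. Qed.

Definition free t x : R -> 'rV[R]_n := flow cfield t x.

Lemma continuous_free t x : continuous (free t x).
Proof. exact: continuous_flow cfield_cont L_gt0 cfield_lip cfield_bnd _ _. Qed.

Lemma free_id t x s : s <= t -> free t x s = x.
Proof. exact: (flow_id cfield_cont L_gt0 cfield_lip cfield_bnd). Qed.

Lemma free_semigroup t x a s : t <= a -> a <= s ->
  free t x s = free a (free t x a) s.
Proof. exact: (flow_semigroup cfield_cont L_gt0 cfield_lip cfield_bnd). Qed.

Lemma free_near_uniform (I : Type) (Fl : set_system I) (FFl : Filter Fl)
    (t_ : I -> R) (x_ : I -> 'rV[R]_n) t x b :
  t_ i @[i --> Fl] --> t -> x_ i @[i --> Fl] --> x ->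
  forall e, 0 < e -> \forall i \near Fl, forall r, t_ i <= r <= b ->
    `|free (t_ i) (x_ i) r - free t x r| <= e.
Proof. exact: (flow_near_uniform cfield_cont L_gt0 cfield_lip cfield_bnd). Qed.

Lemma free_eq t x s : 0 <= t -> s <= T ->
  free t x s = x + vint (fun r => f r (free t x r)) t s.
Proof.
move=> t0 sT; rewrite {1}/free (flowE cfield_cont L_gt0 cfield_lip cfield_bnd).
congr (_ + _); apply: eq_vint => r /andP[tr rs].
by rewrite /cfield clamp_id// (le_trans t0 tr) (le_trans rs sT).
Qed.

Lemma free_integrable t x s : 0 <= t -> s <= T ->
  vintegrable (fun r => f r (free t x r)) t s.
Proof.
move=> t0 sT i.
have := @vintegrable_cc _ _ (fun r => cfield r (free t x r)) t s.
move=> /(_ _ i) h; apply: eq_integrable (h _) => //.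
  move=> r; rewrite inE/= in_itv/= => /andP[tr rs].
  by rewrite /cfield clamp_id// (le_trans t0 tr) (le_trans rs sT).
by apply: continuous_velocity; [exact: cfield_cont|exact: continuous_free].
Qed.

Lemma is_trajectory_nil t x : 0 <= t -> is_trajectory f T t x [::] (free t x).
Proof.
move=> t0; split.
- by move=> s _; exact/cvg_at_right_filter/continuous_free.
- by move=> i; exact: free_integrable.
- move=> s /andP[ts sT]; rewrite [LHS]free_eq// /control_path big_nil addr0.
  by [].
Qed.

(** The value at [tau] is that of [X2], the state after the jump, as right-continuity requires. *)
Definition glue tau X1 X2 s : 'rV[R]_n := if s < tau then X1 s else X2 s.

Lemma glue_lt tau X1 X2 s : s < tau -> glue tau X1 X2 s = X1 s.
Proof. by rewrite /glue => ->. Qed.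

Lemma glue_ge tau X1 X2 s : tau <= s -> glue tau X1 X2 s = X2 s.
Proof. by rewrite /glue leNgt => /negbTE ->. Qed.

(** Before [tau] the control path vanishes and the motion is free. From [tau] on the integral splits
    at [tau], and its first part rebuilds [free t x tau], from which [X] starts after the jump
    [xi]. *)
Lemma is_trajectory_cons t x tau xi u X : 0 <= t -> t <= tau <= T ->
  is_control K T tau u ->
  is_trajectory f T tau (free t x tau + xi) u X ->
  is_trajectory f T t x ((tau, xi) :: u) (glue tau (free t x) X).
Proof.
move=> t0 /andP[ttau tauT] ctu [rX iX XE]; set Y := glue _ _ _.
have iY : vintegrable (fun r => f r (Y r)) t T.
  move=> i; apply: (@integrable_itv_cat _ (fun r => f r (Y r) ord0 i) t tau T) => //.
    have iF := free_integrable x t0 tauT i.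
    apply: (@eq_integrable _ _ _ mu _ _ (fun r => (f r (free t x r) ord0 i)%:E)) => //.
      by move=> r; rewrite inE/= in_itv/= => /andP[_ rt]; rewrite /Y glue_lt.
    by apply: integrableS iF => //; apply: subset_itv; rewrite bnd_simp.
  apply: eq_integrable (iX i) => // r; rewrite inE/= in_itv/= => /andP[tr _].
  by rewrite /Y glue_ge.
split => //.
- move=> s /andP[ts sT]; have [st|taus] := ltP s tau.
    rewrite {2}/Y glue_lt//.
    apply: cvg_trans (cvg_at_right_filter (@continuous_free t x s)).
    apply: near_eq_cvg; apply: filterS (nbhs_right_lt st) => r rt.
    by rewrite /Y glue_lt.
  rewrite {2}/Y glue_ge//.
  apply: cvg_trans (rX s _); last by rewrite taus.
  apply: near_eq_cvg; apply: filterS (nbhs_right_ge s) => r sr.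
  by rewrite /Y glue_ge// (le_trans taus).
- move=> s /andP[ts sT]; rewrite control_path_cons/=.
  have [taus|st] := leP tau s; last first.
    rewrite add0r (control_path_before ctu)// addr0 {1}/Y glue_lt// free_eq//.
    congr (_ + _); apply: eq_vint => r /andP[_ rs].
    by rewrite /Y glue_lt// (le_lt_trans rs).
  rewrite {1}/Y glue_ge// XE ?taus//.
  have -> : \row_i \int[mu]_(r in `[t, s]) f r (Y r) ord0 i =
      vint (fun r => f r (Y r)) t tau + vint (fun r => f r (X r)) tau s.
    rewrite -[LHS]/(vint (fun r => f r (Y r)) t s) (vint_cat ttau taus).
      congr (_ + _); apply: eq_vint => r /andP[tr _]; by rewrite /Y glue_ge.
    exact: vintegrable_subitv iY.
  rewrite (free_eq x t0 tauT) (@eq_vint_co _ _ _ (fun r => f r (Y r))).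
  + by rewrite -!addrA; do 2 congr (_ + _); rewrite addrCA.
  + exact: free_integrable.
  + exact: vintegrable_subitv iY.
  + by move=> r /andP[_ rt]; rewrite /Y glue_lt.
Unshelve. all: by end_near. Qed.

(** On [[t, T]] the field [f] agrees with [cfield], so [velocity_unique] applies. Hence the choice
    made by [get] in [trajectory] is immaterial there. *)
Lemma is_trajectory_unique t x u X Y : 0 <= t ->
  is_trajectory f T t x u X -> is_trajectory f T t x u Y ->
  forall s, t <= s <= T -> X s = Y s.
Proof.
move=> t0 [_ iX XE] [_ iY YE].
have cE (X' : R -> 'rV[R]_n) r : t <= r <= T -> f r (X' r) = cfield r (X' r).
  by move=> /andP[tr rT]; rewrite /cfield clamp_id// (le_trans t0 tr).
have iC (X' : R -> 'rV[R]_n) : vintegrable (fun r => f r (X' r)) t T ->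
    vintegrable (fun r => cfield r (X' r)) t T.
  move=> iX' i; apply: eq_integrable (iX' i) => // r.
  by rewrite inE/= in_itv/= => /cE ->.
apply: (@velocity_unique _ _ cfield L L_gt0 cfield_lip
  (fun s => x + control_path u s)); [exact: iC|exact: iC| |].
- move=> r /[dup] tr /andP[_ rT]; rewrite XE// addrAC; congr (_ + _).
  by apply: eq_vint => s /andP[ts sr]; rewrite cE// ts (le_trans sr).
- move=> r /[dup] tr /andP[_ rT]; rewrite YE// addrAC; congr (_ + _).
  by apply: eq_vint => s /andP[ts sr]; rewrite cE// ts (le_trans sr).
Qed.

Lemma trajectory_exists t x u : 0 <= t -> is_control K T t u ->
  exists X, is_trajectory f T t x u X.
Proof.
elim: u t x => [|[tau xi] u IH] t x t0.
  by move=> _; exists (free t x); exact: is_trajectory_nil.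
move=> /is_control_cons[/= ttau _ cu].
have tau0 : 0 <= tau by case/andP: ttau => + _; exact: le_trans.
have [X tX] := IH tau (free t x tau + xi) tau0 cu.
by exists (glue tau (free t x) X); exact: is_trajectory_cons.
Qed.

Lemma trajectoryP t x u : 0 <= t -> is_control K T t u ->
  is_trajectory f T t x u (trajectory f T t x u).
Proof. by move=> t0 /(trajectory_exists x t0)[X]; exact: getI. Qed.

Lemma trajectory_nil t x s : 0 <= t -> t <= s <= T ->
  trajectory f T t x [::] s = free t x s.
Proof.
move=> t0; apply: (is_trajectory_unique t0).
  exact: trajectoryP (is_control_nil K T t).
exact: is_trajectory_nil.
Qed.

Lemma trajectory_cons t x tau xi u s : 0 <= t -> t <= tau <= T ->
  is_control K T t ((tau, xi) :: u) -> t <= s <= T ->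
  trajectory f T t x ((tau, xi) :: u) s =
  glue tau (free t x) (trajectory f T tau (free t x tau + xi) u) s.
Proof.
move=> t0 ttau cu; apply: (is_trajectory_unique t0).
  exact: trajectoryP cu.
have [_ _ cu'] := (is_control_cons _ _ _ _ _).1 cu.
apply: is_trajectory_cons => //; apply: trajectoryP => //.
by case/andP: ttau => + _; exact: le_trans.
Qed.

(** * Recursive form of the cost *)

Variables (g : R -> 'rV[R]_n -> R) (h : 'rV[R]_n -> R).
Variable l : R -> 'rV[R]_n -> 'rV[R]_n -> R.
Hypothesis g_cont : {within `[0, T] `*` [set: 'rV[R]_n],
  continuous (fun p : R * 'rV[R]_n => g p.1 p.2)}.

Definition running t x s : R := \int[mu]_(r in `[t, s]) g r (free t x r).

(** No left limit occurs: [free t x p.1] is the state just before the first impulse, and for a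
    further impulse at the same time the free stretch has length zero, so the earlier simultaneous
    impulses are already included. *)
Fixpoint payoff t x u : R :=
  if u is p :: u' then
    running t x p.1 + l p.1 (free t x p.1) p.2
    + payoff p.1 (free t x p.1 + p.2) u'
  else running t x T + h (free t x T).

Fixpoint endpoint t x u : 'rV[R]_n :=
  if u is p :: u' then endpoint p.1 (free t x p.1 + p.2) u' else free t x T.

Lemma continuous_clamped_cost t x :
  continuous (fun r => g (clamp T r) (free t x r)).
Proof.
move=> r; apply: (@cvg_within_comp _ _ _ _ _ _
  (fun p : R * 'rV[R]_n => g p.1 p.2) (fun r => (clamp T r, free t x r))
  (clamp T r, free t x r) g_cont).
- by split=> //=; rewrite in_itv/= clamp_itv.
- by apply: nearW => q; split=> //=; rewrite in_itv/= clamp_itv.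
- by apply: cvg_pair_nbhs; [exact: continuous_clamp|exact: continuous_free].
Qed.

Lemma running_integrable t x s : 0 <= t -> s <= T ->
  mu.-integrable `[t, s] (fun r => (g r (free t x r))%:E).
Proof.
move=> t0 sT.
have h1 := @integrable_cc _ (fun r => g (clamp T r) (free t x r)) t s
  (@continuous_clamped_cost t x).
apply: eq_integrable h1 => // r; rewrite inE/= in_itv/= => /andP[tr rs].
by rewrite clamp_id// (le_trans t0 tr) (le_trans rs sT).
Qed.

Lemma running_cat t x a s : 0 <= t -> t <= a -> a <= s -> s <= T ->
  running t x s = running t x a + running a (free t x a) s.
Proof.
move=> t0 ta as_ sT; rewrite /running (Rintegral_cc_cat ta as_); last first.
  exact: running_integrable.
congr (_ + _); apply: eq_Rintegral => r; rewrite inE/= in_itv/= => /andP[ar _].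
by rewrite -free_semigroup.
Qed.

Lemma running_le t x s : s <= t -> running t x s = 0.
Proof. exact: Rintegral_cc_le. Qed.

Lemma integral_trajectory_nil t x s : 0 <= t -> s <= T ->
  (\int[mu]_(r in `[t, s]) (g r (trajectory f T t x [::] r))%:E
   = (running t x s)%:E)%E.
Proof.
move=> t0 sT; rewrite /running EFin_Rintegral//; last exact: running_integrable.
apply: eq_integral => r; rewrite inE/= in_itv/= => /andP[tr rs].
by rewrite trajectory_nil// tr (le_trans rs).
Qed.

Lemma trajectory_end t x u : 0 <= t -> t <= T -> is_control K T t u ->
  trajectory f T t x u T = endpoint t x u.
Proof.
elim: u t x => [|[tau xi] u IH] t x t0 tT cu.
  by rewrite trajectory_nil// tT lexx.
have [/= ttau _ cu'] := (is_control_cons _ _ _ _ _).1 cu.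
have [ttau' tauT] := andP ttau.
rewrite trajectory_cons ?tT ?lexx// glue_ge//= IH//.
exact: le_trans ttau'.
Qed.

Lemma integrable_cost t x u : 0 <= t -> t <= T -> is_control K T t u ->
  mu.-integrable `[t, T] (fun r => (g r (trajectory f T t x u r))%:E).
Proof.
elim: u t x => [|[tau xi] u IH] t x t0 tT cu.
  apply: eq_integrable (running_integrable x t0 (lexx T)) => // r.
  by rewrite inE/= in_itv/= => rT; rewrite trajectory_nil.
have [/= ttau _ cu'] := (is_control_cons _ _ _ _ _).1 cu.
have [ttau' tauT] := andP ttau.
apply: (@integrable_itv_cat _ (fun r => g r (trajectory f T t x _ r)) t tau T) => //.
  apply: (@eq_integrable _ _ _ mu _ _ (fun r => (g r (free t x r))%:E)) => //.
    move=> r; rewrite inE/= in_itv/= => /andP[tr rt].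
    by rewrite trajectory_cons ?glue_lt// tr ltW// (lt_le_trans rt).
  apply: integrableS (running_integrable x t0 tauT) => //.
  by apply: subset_itv; rewrite bnd_simp.
have := IH tau (free t x tau + xi) (le_trans t0 ttau') tauT cu'.
apply: eq_integrable => // r; rewrite inE/= in_itv/= => /andP[tr rT].
by rewrite trajectory_cons ?glue_ge// rT (le_trans ttau').
Qed.

Lemma Rintegral_cost_cons t x tau xi u :
  0 <= t -> t <= T -> is_control K T t ((tau, xi) :: u) ->
  \int[mu]_(r in `[t, T]) g r (trajectory f T t x ((tau, xi) :: u) r) =
  running t x tau
  + \int[mu]_(r in `[tau, T]) g r (trajectory f T tau (free t x tau + xi) u r).
Proof.
move=> t0 tT cu; have [/= ttau _ cu'] := (is_control_cons _ _ _ _ _).1 cu.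
have [ttau' tauT] := andP ttau; have iX := integrable_cost x t0 tT cu.
rewrite (Rintegral_cc_cat ttau' tauT)//; congr (_ + _); last first.
  apply: eq_Rintegral => r; rewrite inE/= in_itv/= => /andP[tr rT].
  by rewrite trajectory_cons ?glue_ge// rT (le_trans ttau').
have s : `[t, tau[%classic `<=` `[t, tau]%classic.
  by apply: subset_itv; rewrite bnd_simp.
rewrite /running -!Rintegral_itv_bndo_bndc; first last.
- by apply: integrableS iX => //; apply: subset_itv; rewrite bnd_simp.
- by apply: integrableS (running_integrable x t0 tauT).
apply: eq_Rintegral => r; rewrite inE/= in_itv/= => /andP[tr rt].
by rewrite trajectory_cons ?glue_lt// tr (ltW (lt_le_trans rt tauT)).
Qed.

Lemma lim_at_left_eq (X Y : R -> 'rV[R]_n) a b : a < b ->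
  (forall r, a <= r < b -> X r = Y r) ->
  lim (X r @[r --> b^'-]) = lim (Y r @[r --> b^'-]).
Proof.
move=> ab XY; congr lim; apply/seteqP; split; apply: near_eq_cvg;
  near=> r; rewrite XY//; apply/andP; split; near: r;
  [exact: nbhs_left_ge|exact: nbhs_left_lt|exact: nbhs_left_ge|exact: nbhs_left_lt].
Unshelve. all: by end_near. Qed.

(** For [tau = t] this is the convention that the state before time [t] is [x]; otherwise the left
    limit is taken along the free motion, which is continuous. *)
Lemma pre_state_first t x tau xi u : 0 <= t -> t <= T ->
  is_control K T t ((tau, xi) :: u) ->
  (if tau == t then x
   else lim (trajectory f T t x ((tau, xi) :: u) r @[r --> tau^'-]))
  = free t x tau.
Proof.
move=> t0 tT cu; have [/= ttau _ cu'] := (is_control_cons _ _ _ _ _).1 cu.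
have [ttau' tauT] := andP ttau.
case: eqVneq => [->|taut]; first by rewrite free_id.
have lt_ttau : t < tau by rewrite lt_neqAle eq_sym taut.
rewrite (@lim_at_left_eq _ (free t x) t)//.
  apply: cvg_lim => //.
  exact/cvg_at_left_filter/continuous_free.
move=> r /andP[tr rt].
by rewrite trajectory_cons ?glue_lt// tr (ltW (lt_le_trans rt tauT)).
Qed.

(** If the impulse of index [k.+1] acts at [tau], dropping the first impulse moves [xi] from the sum
    of simultaneous impulses into the starting state. Otherwise only the left limit matters, and the
    two trajectories agree between [tau] and that impulse. *)
Lemma pre_state_cons t x tau xi u k : 0 <= t -> t <= T ->
  is_control K T t ((tau, xi) :: u) -> (k < size u)%N ->
  pre_state t x ((tau, xi) :: u) (trajectory f T t x ((tau, xi) :: u)) k.+1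
  = pre_state tau (free t x tau + xi) u
      (trajectory f T tau (free t x tau + xi) u) k.
Proof.
move=> t0 tT cu ku; have [/= ttau _ cu'] := (is_control_cons _ _ _ _ _).1 cu.
have [ttau' tauT] := andP ttau.
rewrite /pre_state big_mkcond big_ord_recl /= -big_mkcond.
set s := nth _ _ _; set S := (\sum_(j < k | _) _).
have [/andP[taus sT] _] : tau <= s.1 <= T /\ K s.2 by apply: cu'.2; exact: mem_nth.
have [st|taus'] := eqVneq s.1 tau.
  by rewrite st addrA pre_state_first.
have lt_taus : tau < s.1 by rewrite lt_neqAle eq_sym taus'.
rewrite gt_eqF ?(le_lt_trans ttau')// add0r.
congr (_ + _); apply: (lim_at_left_eq lt_taus) => r /andP[tr rs].
by rewrite trajectory_cons ?glue_ge// (le_trans ttau' tr) (ltW (lt_le_trans rs sT)).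
Qed.

(** The impulses are peeled off one at a time: [Rintegral_cost_cons] splits the running cost and
    [pre_state_cons] reindexes the impulse costs. *)
Lemma costE t x u : 0 <= t -> t <= T -> is_control K T t u ->
  cost f g h l T t x u = (payoff t x u)%:E.
Proof.
move=> t0 tT cu; rewrite /cost.
have -> : (\int[mu]_(s in `[t, T]) (g s (trajectory f T t x u s))%:E
    = (\int[mu]_(s in `[t, T]) g s (trajectory f T t x u s))%:E)%E.
  by rewrite EFin_Rintegral//; exact: integrable_cost.
rewrite -!EFinD trajectory_end//; congr EFin.
elim: u t x t0 tT cu => [|[tau xi] u IH] t x t0 tT cu.
  rewrite big_ord0 addr0 /=; congr (_ + _); apply: eq_Rintegral => r.
  by rewrite inE/= in_itv/= => rT; rewrite trajectory_nil.
have [/= ttau _ cu'] := (is_control_cons _ _ _ _ _).1 cu.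
have [ttau' tauT] := andP ttau.
rewrite Rintegral_cost_cons// big_ord_recl /= -IH ?(le_trans t0)//.
have -> : pre_state t x ((tau, xi) :: u)
    (trajectory f T t x ((tau, xi) :: u)) 0 = free t x tau.
  by rewrite /pre_state big_ord0 addr0 /= pre_state_first.
rewrite (eq_bigr (fun k : 'I_(size u) => l (nth (0, 0) u k).1
  (pre_state tau (free t x tau + xi) u
     (trajectory f T tau (free t x tau + xi) u) k) (nth (0, 0) u k).2)).
  by rewrite !addrA; ring.
by move=> k _; rewrite pre_state_cons.
Qed.

(** * Closedness of the cost *)

Hypothesis g_ge0 : forall r x, 0 <= r <= T -> 0 <= g r x.
Hypothesis g_unif : forall M e : R, 0 < e -> exists2 d, 0 < d &
  forall r x y, 0 <= r <= T -> `|x| <= M -> `|y| <= M -> `|x - y| <= d ->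
    `|g r x - g r y| <= e.
Hypothesis h_ge0 : forall x, 0 <= h x.
Hypothesis h_cont : continuous h.
Hypothesis K_closed : closed K.
Hypothesis l_cont : {within `[0, T] `*` [set: 'rV[R]_n] `*` K,
  continuous (fun p : R * 'rV[R]_n * 'rV[R]_n => l p.1.1 p.1.2 p.2)}.
Variable l0 : R.
Hypothesis l0_gt0 : 0 < l0.
Hypothesis l_ge : forall t x xi, 0 <= t <= T -> K xi -> l0 <= l t x xi.
Hypothesis l_coercive : forall M : R, exists rho : R,
  forall t x xi, 0 <= t <= T -> K xi -> l t x xi <= M -> `|xi| <= rho.
Variable D : set 'rV[R]_n.

Lemma running_ge0 t x s : 0 <= t -> s <= T -> 0 <= running t x s.
Proof.
move=> t0 sT; apply: Rintegral_ge0 => r /=; rewrite in_itv/= => /andP[tr rs].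
by rewrite g_ge0// (le_trans t0 tr) (le_trans rs sT).
Qed.

(** Turns a bound on the payoff into a bound on the number of impulses, all other terms being
    nonnegative. *)
Lemma payoff_size t x u : 0 <= t -> t <= T -> is_control K T t u ->
  (size u)%:R * l0 <= payoff t x u.
Proof.
elim: u t x => [|p u IH] t x t0 tT cu.
  by rewrite mul0r addr_ge0 ?running_ge0.
have [/andP[tp pT] Kp cu'] := (is_control_cons _ _ _ _ _).1 cu.
have p0 := le_trans t0 tp.
rewrite /= -[(size u).+1]addn1 natrD mulrDl mul1r addrC lerD ?IH//.
by rewrite -[leLHS]add0r lerD ?running_ge0// l_ge// p0.
Qed.

Lemma payoff_ge0 t x u : 0 <= t -> t <= T -> is_control K T t u ->
  0 <= payoff t x u.
Proof.
by move=> t0 tT cu; rewrite (le_trans _ (payoff_size x t0 tT cu))// mulr_ge0// ltW.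
Qed.

(** * Limits of free motions and of running costs *)

Section FilterLimits.
Variables (I : Type) (Fl : set_system I).
Context {FFl : ProperFilter Fl}.
Variables (t_ s_ : I -> R) (x_ : I -> 'rV[R]_n) (t s : R) (x : 'rV[R]_n).
Hypothesis t_cvg : t_ i @[i --> Fl] --> t.
Hypothesis s_cvg : s_ i @[i --> Fl] --> s.
Hypothesis x_cvg : x_ i @[i --> Fl] --> x.
Hypothesis ts_ : \forall i \near Fl, t_ i <= s_ i.

Lemma free_cvg : free (t_ i) (x_ i) (s_ i) @[i --> Fl] --> free t x s.
Proof.
apply/cvgrPdist_le => e e0.
have e20 : 0 < e / 2 by exact: divr_gt0.
have cX := @continuous_free t x s.
have sX : free t x (s_ i) @[i --> Fl] --> free t x s by exact: continuous_cvg.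
near=> i; rewrite -[_ - _](subrKA (free t x (s_ i))) (le_trans (ler_normD _ _))//.
rewrite (splitr e) lerD//.
  by near: i; move/cvgrPdist_le : sX; apply.
rewrite distrC.
(* The uniform estimate wants a fixed right end; [s + 1] eventually dominates the moving times
   [s_ i]. *)
have h1 : forall r, t_ i <= r <= s + 1 ->
    `|free (t_ i) (x_ i) r - free t x r| <= e / 2.
  by near: i; exact: free_near_uniform.
apply: h1; apply/andP; split; near: i => //.
by apply: (cvgr_le _ s_cvg); rewrite ltrDl.
Unshelve. all: by end_near. Qed.

Hypothesis t_ge0 : \forall i \near Fl, 0 <= t_ i.
Hypothesis s_leT : \forall i \near Fl, s_ i <= T.

(** The running cost is the integral of the fixed function [q], whose primitive [J] is continuous,
    plus an error [d i] due to the perturbed motion. Uniform closeness of the motions and [g_unif]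
    make the error small. *)
Lemma running_cvg : running (t_ i) (x_ i) (s_ i) @[i --> Fl] --> running t x s.
Proof.
pose X := free t x; pose q r := g (clamp T r) (X r).
have cq : continuous q by exact: continuous_clamped_cost.
pose J a := \int[mu]_(r in `[0, a]) q r.
have qJ a b : 0 <= a -> a <= b -> \int[mu]_(r in `[a, b]) q r = J b - J a.
  move=> a0 ab; rewrite /J (Rintegral_cc_cat a0 ab); last exact: integrable_cc.
  by rewrite addrC addKr.
have cJ : continuous J by exact: continuous_Rintegral_cc.
have t0 : 0 <= t by exact: (cvgr_to_ge t_cvg).
have sT : s <= T by exact: (cvgr_to_le s_cvg).
have ts : t <= s by exact: (le_cvgr t_cvg s_cvg ts_).
have qE a b : 0 <= a -> b <= T -> forall r, a <= r <= b -> g r (X r) = q r.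
  move=> a0 bT r /andP[ar rb].
  by rewrite /q clamp_id// (le_trans a0 ar) (le_trans rb).
have -> : running t x s = 0 + (J s - J t).
  rewrite add0r -qJ//; apply: eq_Rintegral => r; rewrite inE/= in_itv/=; exact: qE.
pose d i := running (t_ i) (x_ i) (s_ i) - (J (s_ i) - J (t_ i)).
have -> : (fun i => running (t_ i) (x_ i) (s_ i)) =
    (fun i => d i + (J (s_ i) - J (t_ i))) by apply/funext => i; rewrite subrK.
apply: cvgD; last first.
  by apply: cvgB; [exact: cvg_comp s_cvg (cJ s)|exact: cvg_comp t_cvg (cJ t)].
apply/cvgrPdist_le => e e0.
have [M XM] : exists M, forall r, 0 <= r <= T -> `|X r| <= M.
  have cN : {within `[0, T], continuous (fun r => `|X r|)}.
    apply: continuous_subspaceT => r.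
    apply: continuous_comp; last exact: norm_continuous.
    exact: continuous_free.
  have [c _ cmax] := EVT_max T_ge0 cN.
  by exists `|X c| => r rT; apply: cmax; rewrite in_itv.
(* The time intervals have length at most [T]; dividing by [T + 1] keeps the quotient positive even
   for [T = 0]. *)
have eT : 0 < e / (T + 1) by rewrite divr_gt0// ltr_wpDl.
have [b b0 gb] := g_unif (M + 1) eT.
(* Closeness within 1 keeps the perturbed motion in the ball of radius [M + 1], where the modulus
   [b] is valid. *)
have m0 : 0 < Num.min b 1 by rewrite lt_min b0 ltr01.
near=> i; rewrite sub0r normrN.
have ti0 : 0 <= t_ i by near: i.
have si : s_ i <= T by near: i.
have tsi : t_ i <= s_ i by near: i.
have unif : forall r, t_ i <= r <= T -> `|free (t_ i) (x_ i) r - X r| <= Num.min b 1.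
  by near: i; exact: free_near_uniform.
rewrite /d -qJ//.
have -> : \int[mu]_(r in `[t_ i, s_ i]) q r = \int[mu]_(r in `[t_ i, s_ i]) g r (X r).
  by apply: eq_Rintegral => r; rewrite inE/= in_itv/= => /(qE _ _ ti0 si) ->.
have iX : mu.-integrable `[t_ i, s_ i] (EFin \o (fun r => g r (X r))).
  apply: eq_integrable (integrable_cc _ _ cq) => // r.
  by rewrite inE/= in_itv/= => /(qE _ _ ti0 si) /= ->.
have iY := running_integrable (x_ i) ti0 si.
rewrite /running -RintegralB//.
apply: (le_trans (norm_Rintegral_le_cst (M := e / (T + 1)) tsi _ _)).
- by have := integrableB _ iY iX; exact.
- move=> r /andP[tr rs]; have rT := le_trans rs si.
  have rr : 0 <= r <= T by rewrite (le_trans ti0 tr).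
  have := unif r; rewrite tr rT le_min => /(_ isT)/andP[u1 u2].
  apply: gb => //; last by rewrite (le_trans (XM _ rr))// lerDl.
  rewrite -[free _ _ _](subrK (X r)) (le_trans (ler_normD _ _))//.
  by rewrite addrC lerD// XM.
rewrite mulrAC ler_pdivrMr ?ltr_wpDl// ler_wpM2l ?(ltW e0)//.
by rewrite (le_trans (lerB si ti0))// subr0 lerDl.
Unshelve. all: by end_near. Qed.

End FilterLimits.

Lemma impulse_cost_cvg (I : Type) (Fl : set_system I) {FFl : ProperFilter Fl}
    (t_ : I -> R) (x_ xi_ : I -> 'rV[R]_n) t x xi : 0 <= t <= T -> K xi ->
  (\forall i \near Fl, 0 <= t_ i <= T) -> (\forall i \near Fl, K (xi_ i)) ->
  t_ i @[i --> Fl] --> t -> x_ i @[i --> Fl] --> x ->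
  xi_ i @[i --> Fl] --> xi ->
  l (t_ i) (x_ i) (xi_ i) @[i --> Fl] --> l t x xi.
Proof.
move=> tT Kxi tT_ Kxi_ tc xc xic.
apply: (@cvg_within_comp _ _ _ _ _ _
  (fun p : R * 'rV[R]_n * 'rV[R]_n => l p.1.1 p.1.2 p.2)
  (fun i => (t_ i, x_ i, xi_ i)) (t, x, xi) l_cont).
- by split=> //=; split=> //=; rewrite in_itv.
- by apply: filterS2 tT_ Kxi_ => i tTi Ki; split=> //=; split=> //=; rewrite in_itv.
- by apply: cvg_pair_nbhs => //; exact: cvg_pair_nbhs.
Qed.

Lemma payoff_closed_nil (I : Type) (Fl : set_system I) {FFl : ProperFilter Fl}
    (t_ c_ : I -> R) (x_ : I -> 'rV[R]_n) t c x :
  t_ i @[i --> Fl] --> t -> x_ i @[i --> Fl] --> x -> c_ i @[i --> Fl] --> c ->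
  (\forall i \near Fl, 0 <= t_ i) -> (\forall i \near Fl, t_ i <= T) ->
  (\forall i \near Fl, closure D (free (t_ i) (x_ i) T)) ->
  (\forall i \near Fl, payoff (t_ i) (x_ i) [::] <= c_ i) ->
  closure D (free t x T) /\ payoff t x [::] <= c.
Proof.
move=> tc xc cc t0 tT Du pu.
have Tc : (fun=> T) i @[i --> Fl] --> T by exact: cvg_cst.
have fc : free (t_ i) (x_ i) T @[i --> Fl] --> free t x T.
  exact: free_cvg tc Tc xc tT.
split; first exact: closed_cvg (@closed_closure _ D) Du _ fc.
apply: (le_cvgr _ cc pu); apply: cvgD.
  by apply: (running_cvg tc Tc xc tT t0); exact: nearW.
exact: cvg_comp fc (@h_cont _).
Qed.

(* Impulse times that merge in the limit are harmless, since a control may carry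
   several ordered impulses at one time. *)
Lemma payoff_closed N (I : Type) (Fl : set_system I) (t_ c_ : I -> R)
    (x_ : I -> 'rV[R]_n) (u_ : I -> impulses R n) t c x : UltraFilter Fl ->
  t_ i @[i --> Fl] --> t -> x_ i @[i --> Fl] --> x -> c_ i @[i --> Fl] --> c ->
  (\forall i \near Fl, [/\ 0 <= t_ i, t_ i <= T, is_control K T (t_ i) (u_ i) &
    (size (u_ i) <= N)%N]) ->
  (\forall i \near Fl, closure D (endpoint (t_ i) (x_ i) (u_ i)) /\
    payoff (t_ i) (x_ i) (u_ i) <= c_ i) ->
  exists u, [/\ is_control K T t u, closure D (endpoint t x u) &
    payoff t x u <= c].
Proof.
move=> FU.
have FP := @ultra_proper _ _ FU.
have nil (t_' c_' : I -> R) (x_' : I -> 'rV[R]_n) (u_' : I -> impulses R n) t' c' x' :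
    t_' i @[i --> Fl] --> t' -> x_' i @[i --> Fl] --> x' ->
    c_' i @[i --> Fl] --> c' ->
    (\forall i \near Fl, 0 <= t_' i) -> (\forall i \near Fl, t_' i <= T) ->
    (\forall i \near Fl, closure D (endpoint (t_' i) (x_' i) (u_' i)) /\
      payoff (t_' i) (x_' i) (u_' i) <= c_' i) ->
    (\forall i \near Fl, u_' i = [::]) ->
    exists u, [/\ is_control K T t' u, closure D (endpoint t' x' u) &
      payoff t' x' u <= c'].
  move=> tc xc cc t0 tT pu u0; exists [::].
  have [||Dx px] := payoff_closed_nil tc xc cc t0 tT.
  - by apply: filterS2 u0 pu => i -> [].
  - by apply: filterS2 u0 pu => i -> [].
  - by split=> //; exact: is_control_nil.
elim: N t_ c_ x_ u_ t c x => [|N IH] t_ c_ x_ u_ t c x tc xc cc cu pu.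
  apply: nil tc xc cc _ _ pu _; apply: filterS cu => i [] //.
  by rewrite leqn0 => _ _ _ /nilP.
(* The ultrafilter decides between lists that are eventually empty and lists that eventually have a
   first impulse. *)
have [|cons] := in_ultra_setVsetC [set i | u_ i = [::]] FU.
  by apply: nil tc xc cc _ _ pu; apply: filterS cu => i [].
pose p_ i := head (0, 0) (u_ i); pose v_ i := behead (u_ i).
have uE : \forall i \near Fl, u_ i = p_ i :: v_ i.
  by apply: filterS cons => i /=; rewrite /p_ /v_; case: (u_ i).
have c1 : \forall i \near Fl, c_ i <= c + 1.
  by apply: (cvgr_le _ cc); rewrite ltrDl.
have [rho rhoP] := l_coercive (c + 1).
have inf : \forall i \near Fl, [/\ 0 <= t_ i, t_ i <= (p_ i).1, (p_ i).1 <= T,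
    K (p_ i).2 & [/\ is_control K T (p_ i).1 (v_ i), (size (v_ i) <= N)%N &
    `|(p_ i).2| <= rho]].
  near=> i; have ui : u_ i = p_ i :: v_ i by near: i.
  have [ti0 tiT cui sui] : [/\ 0 <= t_ i, t_ i <= T, is_control K T (t_ i) (u_ i) &
    (size (u_ i) <= N.+1)%N] by near: i.
  have [_ pui] : closure D (endpoint (t_ i) (x_ i) (u_ i)) /\
    payoff (t_ i) (x_ i) (u_ i) <= c_ i by near: i.
  rewrite ui in cui sui pui.
  have [/andP[tp pT] Kp cv] := (is_control_cons _ _ _ _ _).1 cui.
  have p0 := le_trans ti0 tp.
  have pp : 0 <= (p_ i).1 <= T by rewrite p0.
  split=> //; split => //.
  (* The other terms of the payoff are nonnegative, so the first impulse alone costs at most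
     [c_ i <= c + 1]. *)
  apply: (rhoP _ (free (t_ i) (x_ i) (p_ i).1) _ pp Kp).
  have ci : c_ i <= c + 1 by near: i.
  apply: le_trans ci; apply: le_trans pui => /=.
  by rewrite addrAC lerDr addr_ge0 ?running_ge0// payoff_ge0.
have ptT : \forall i \near Fl, `[0, T]%classic (p_ i).1.
  by apply: filterS inf => i [t0 tp pT _ _] /=; rewrite in_itv/= pT (le_trans t0).
have prho : \forall i \near Fl, [set y : 'rV[R]_n | `|y| <= rho] (p_ i).2.
  by apply: filterS inf => i [_ _ _ _ []].
have [tau] := compact_ultra_cvg FU (@segment_compact _ _ _) ptT.
rewrite /= in_itv/= => tauT tauc.
have [xi _ xic] := compact_ultra_cvg FU (@closed_ball0_compact R n rho) prho.
have Kp_ : \forall i \near Fl, K (p_ i).2 by apply: filterS inf => i [].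
have Kxi : K xi by exact: closed_cvg K_closed Kp_ _ xic.
have tle : \forall i \near Fl, t_ i <= (p_ i).1 by apply: filterS inf => i [].
have pleT : \forall i \near Fl, (p_ i).1 <= T by apply: filterS inf => i [].
have tge0 : \forall i \near Fl, 0 <= t_ i by apply: filterS inf => i [].
have ptau : t <= tau by exact: (le_cvgr tc tauc tle).
have fc : free (t_ i) (x_ i) (p_ i).1 @[i --> Fl] --> free t x tau.
  exact: free_cvg tc tauc xc tle.
have rc : running (t_ i) (x_ i) (p_ i).1 @[i --> Fl] --> running t x tau.
  exact: running_cvg tc tauc xc tle tge0 pleT.
have lc : l (p_ i).1 (free (t_ i) (x_ i) (p_ i).1) (p_ i).2 @[i --> Fl] -->
    l tau (free t x tau) xi.
  have p0T : \forall i \near Fl, 0 <= (p_ i).1 <= T.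
    by apply: filterS ptT => i; rewrite /= in_itv.
  exact: impulse_cost_cvg tauT Kxi p0T Kp_ tauc fc xic.
(* The tails are handled with the budget [c_ i] reduced by the cost up to and including the first
   impulse, which converges by [rc] and [lc]. *)
have := IH (fun i => (p_ i).1)
  (fun i => c_ i - (running (t_ i) (x_ i) (p_ i).1
    + l (p_ i).1 (free (t_ i) (x_ i) (p_ i).1) (p_ i).2))
  (fun i => free (t_ i) (x_ i) (p_ i).1 + (p_ i).2) v_ tau
  (c - (running t x tau + l tau (free t x tau) xi)) (free t x tau + xi) tauc
  (cvgD fc xic) (cvgB cc (cvgD rc lc)).
case.
- by apply: filterS inf => i [t0 tp pT Kp [cv sv _]]; rewrite (le_trans t0).
- by apply: filterS2 uE pu => i -> /= [? ?]; split=> //; rewrite lerBrDl.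
move=> u [cu' du pu']; exists ((tau, xi) :: u); split=> //=.
  by apply/is_control_cons; split=> //=; rewrite ptau; case/andP: tauT.
by rewrite -lerBrDl.
Unshelve. all: by end_near. Qed.

(** * The value function *)

Hypothesis K_0 : K 0.
Hypothesis K_D : forall xi xi', K xi -> K xi' -> K (xi + xi').
Hypothesis l_sub : forall x xi xi', K xi -> K xi' ->
  l T x (xi + xi') <= l T x xi + l T (x + xi) xi'.
Hypothesis KD : forall x, exists2 xi, K xi & closure D (x + xi).

Local Notation V := (value K D f g h l T).

Lemma admissibleP t x u : 0 <= t -> t <= T -> admissible K D f T t x u <->
  is_control K T t u /\ closure D (endpoint t x u).
Proof.
move=> t0 tT; rewrite /admissible /=.
by split=> -[cu]; rewrite trajectory_end.
Qed.

Lemma value_le_payoff t x u : 0 <= t -> t <= T -> is_control K T t u ->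
  closure D (endpoint t x u) -> (V t x <= (payoff t x u)%:E)%E.
Proof.
move=> t0 tT cu Du; rewrite -costE//; apply: ereal_inf_lbound.
by exists u => //; apply/admissibleP.
Qed.

Lemma value_ge0 t x : 0 <= t -> t <= T -> (0 <= V t x)%E.
Proof.
move=> t0 tT; apply: le_ereal_inf_tmp => _ [u /admissibleP[]// cu _ <-].
by rewrite costE// lee_fin payoff_ge0.
Qed.

Lemma value_lt t x (c : R) : 0 <= t -> t <= T -> (V t x < c%:E)%E ->
  exists u, [/\ is_control K T t u, closure D (endpoint t x u) &
    payoff t x u <= c].
Proof.
move=> t0 tT /ereal_inf_lt[_ [u /admissibleP[]// cu Du <-]].
by rewrite costE// lte_fin => /ltW uc; exists u.
Qed.

(** Lower semicontinuity of [V t] together with attainment. Constant starting points give optimal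
    controls; starting points [x + xi_ k] give the minimum in the operator [N]. *)
Lemma value_lsc (I : Type) (Fl : set_system I) (x_ : I -> 'rV[R]_n)
    (c_ : I -> R) t x c : UltraFilter Fl -> 0 <= t -> t <= T ->
  x_ i @[i --> Fl] --> x -> c_ i @[i --> Fl] --> c ->
  (\forall i \near Fl, (V t (x_ i) < (c_ i)%:E)%E) ->
  exists u, [/\ is_control K T t u, closure D (endpoint t x u) &
    payoff t x u <= c].
Proof.
move=> FU t0 tT xc cc Vc; have FP := @ultra_proper _ _ FU.
have ex i : exists u, (V t (x_ i) < (c_ i)%:E)%E ->
    [/\ is_control K T t u, closure D (endpoint t (x_ i) u) &
      payoff t (x_ i) u <= c_ i].
  have [/(value_lt t0 tT)[u uP]|nV] := pselect (V t (x_ i) < (c_ i)%:E)%E.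
    by exists u.
  (* A default that makes the choice of [u_] total; it is never taken eventually along [Fl]. *)
  by exists [::].
pose u_ i := sval (cid (ex i)).
have uP : \forall i \near Fl, [/\ is_control K T t (u_ i),
    closure D (endpoint t (x_ i) (u_ i)) & payoff t (x_ i) (u_ i) <= c_ i].
  by apply: filterS Vc => i; exact: (svalP (cid (ex i))).
(* Eventually the payoffs are at most [c + 1] while each impulse costs at least [l0]. *)
pose N := Num.bound ((c + 1) / l0).
have c1 : \forall i \near Fl, c_ i <= c + 1.
  by apply: (cvgr_le _ cc); rewrite ltrDl.
have tc : (fun=> t) i @[i --> Fl] --> t by exact: cvg_cst.
apply: (@payoff_closed N _ Fl (fun=> t) c_ x_ u_) => //; last first.
  by apply: filterS uP => i [].
apply: filterS2 c1 uP => i ci [cu _ pu]; split=> //.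
have := payoff_size (x_ i) t0 tT cu => /le_trans/(_ pu)/le_trans/(_ ci).
rewrite -ler_pdivlMr// => sN; rewrite -(ler_nat R) (le_trans sN)// ltW//.
apply: archi_boundP; rewrite divr_ge0 ?(ltW l0_gt0)// (le_trans _ ci)//.
by rewrite (le_trans _ pu)// payoff_ge0.
Qed.

Lemma ultra_oo : exists2 Fl : set_system nat, UltraFilter Fl &
  forall (U : topologicalType) (y_ : nat -> U) (y : U),
    y_ k @[k --> \oo] --> y -> y_ k @[k --> Fl] --> y.
Proof.
have [Fl [FU sub]] := ultraFilterLemma (eventually_filter : ProperFilter \oo).
by exists Fl => // U y_ y yc P yP; exact: sub (yc P yP).
Qed.

Lemma cvg_add_harmonic (m : R) : m + k.+1%:R^-1 @[k --> \oo] --> m.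
Proof.
rewrite -[X in _ --> X]addr0; apply: cvgD; first exact: cvg_cst.
exact: cvg_harmonic.
Qed.

Lemma lt_add_harmonic (m : R) k : m < m + k.+1%:R^-1.
Proof. by rewrite ltrDl invr_gt0. Qed.

Lemma value_attained t x : 0 <= t -> t <= T -> (V t x < +oo)%E ->
  exists u, [/\ is_control K T t u, closure D (endpoint t x u) &
    V t x = (payoff t x u)%:E].
Proof.
move=> t0 tT Vfin.
have vE : V t x = (fine (V t x))%:E by rewrite fineK// ge0_fin_numE// value_ge0.
have [Fl FU sub] := ultra_oo.
have FP := @ultra_proper _ _ FU.
have xc : (fun=> x) k @[k --> Fl] --> x by exact: cvg_cst.
have cc := sub _ _ _ (@cvg_add_harmonic (fine (V t x))).
have Vc : \forall k \near Fl, (V t x < (fine (V t x) + k.+1%:R^-1)%:E)%E.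
  by apply: nearW => k; rewrite {1}vE lte_fin lt_add_harmonic.
have [u [cu Du pu]] := value_lsc FU t0 tT xc cc Vc.
exists u; split=> //; apply/eqP; rewrite eq_le value_le_payoff//=.
by rewrite vE lee_fin.
Qed.

Lemma payoff_first t x xi u : 0 <= t ->
  payoff t x ((t, xi) :: u) = l t x xi + payoff t (x + xi) u.
Proof. by move=> t0; rewrite /= running_le// free_id// add0r. Qed.

(** Hidden [placeholder] *)
Lemma payoff_shift t th x u : 0 <= t -> t <= th -> th <= T ->
  is_control K T th u ->
  payoff t x u = running t x th + payoff th (free t x th) u.
Proof.
case: u => [|p u] t0 tth thT.
  by move=> _ /=; rewrite (running_cat x t0 tth thT)// -free_semigroup// addrA.
move=> /is_control_cons[/andP[thp pT] _ _] /=.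
by rewrite (running_cat x t0 tth thp)// -!free_semigroup// !addrA.
Qed.

Lemma endpoint_shift t th x u : t <= th -> th <= T -> is_control K T th u ->
  endpoint t x u = endpoint th (free t x th) u.
Proof.
case: u => [|p u] tth thT; first by move=> _ /=; rewrite -free_semigroup.
by move=> /is_control_cons[/andP[thp pT] _ _] /=; rewrite -free_semigroup.
Qed.

Lemma value_le_impulse t x xi : 0 <= t -> t <= T -> K xi ->
  (V t x <= V t (x + xi) + (l t x xi)%:E)%E.
Proof.
move=> t0 tT Kxi; have [Vfin|] := ltP (V t (x + xi)) +oo%E; last first.
  by rewrite leye_eq => /eqP ->; rewrite addye// leey.
have [u [cu Du ->]] := value_attained t0 tT Vfin.
rewrite -EFinD addrC -payoff_first//; apply: value_le_payoff => //.
  by apply/is_control_cons; rewrite /= lexx tT.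
by rewrite /= free_id.
Qed.

Lemma N_attained t x : 0 <= t -> t <= T -> attains_inf (N_values K l V t x).
Proof.
move=> t0 tT; rewrite /attains_inf; set S := N_values _ _ _ _ _.
have Sge0 : (0 <= ereal_inf S)%E.
  apply: le_ereal_inf_tmp => _ [xi Kxi <-]; rewrite adde_ge0 ?value_ge0// lee_fin.
  by rewrite (le_trans (ltW l0_gt0))// l_ge// t0.
have [Sfin|] := ltP (ereal_inf S) +oo%E; last first.
  rewrite leye_eq => /eqP Sy; rewrite Sy; exists 0 => //.
  by apply/eqP; rewrite -leye_eq -Sy; apply: ereal_inf_lbound; exists 0.
have mE : ereal_inf S = (fine (ereal_inf S))%:E by rewrite fineK// ge0_fin_numE.
set m := fine _ in mE.
have ex k : exists xi, K xi /\ (V t (x + xi) < (m + k.+1%:R^-1 - l t x xi)%:E)%E.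
  have /ereal_inf_lt[_ [xi Kxi <-] Vm] : (ereal_inf S < (m + k.+1%:R^-1)%:E)%E.
    by rewrite mE lte_fin lt_add_harmonic.
  by exists xi; split=> //; rewrite EFinB lteBrDr.
pose xi_ k := sval (cid (ex k)).
have KV k : K (xi_ k) /\ (V t (x + xi_ k) < (m + k.+1%:R^-1 - l t x (xi_ k))%:E)%E.
  exact: (svalP (cid (ex k))).
have tT' : 0 <= t <= T by rewrite t0.
have [rho rhoP] := l_coercive (m + 1).
have [Fl FU sub] := ultra_oo.
have FP := @ultra_proper _ _ FU.
have xrho : \forall k \near Fl, [set y : 'rV[R]_n | `|y| <= rho] (xi_ k).
  apply: nearW => k /=; apply: (rhoP t x _ tT' (KV k).1).
  have := le_lt_trans (value_ge0 (x + xi_ k) t0 tT) (KV k).2.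
  rewrite lte_fin subr_gt0 => /ltW/le_trans; apply.
  by rewrite lerD2l invf_le1// ler1n.
have [xi _ xic] := compact_ultra_cvg FU (@closed_ball0_compact R n rho) xrho.
have Kxi : K xi.
  by apply: closed_cvg K_closed _ _ xic; apply: nearW => k; exact: (KV k).1.
have lc : l t x (xi_ k) @[k --> Fl] --> l t x xi.
  apply: (@impulse_cost_cvg _ Fl FP (fun=> t) (fun=> x)) => //.
  - exact: nearW.
  - by apply: nearW => k; exact: (KV k).1.
  - exact: cvg_cst.
  - exact: cvg_cst.
have xxic : x + xi_ k @[k --> Fl] --> x + xi by apply: cvgD => //; exact: cvg_cst.
have cc : m + k.+1%:R^-1 - l t x (xi_ k) @[k --> Fl] --> m - l t x xi.
  by apply: cvgB => //; exact: sub (@cvg_add_harmonic m).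
have [u [cu Du pu]] := value_lsc FU t0 tT xxic cc (nearW _ (fun k => (KV k).2)).
exists xi => //; apply/eqP; rewrite eq_le; apply/andP; split; last first.
  by apply: ereal_inf_lbound; exists xi.
rewrite mE -leeBrDr// -EFinB (le_trans (value_le_payoff t0 tT cu Du))//.
Qed.

Lemma ND_attained x : attains_inf (ND_values K D l T h x).
Proof.
have TT : 0 <= T <= T by rewrite T_ge0 lexx.
rewrite /attains_inf; set S := ND_values _ _ _ _ _ _.
have Sge0 : (0 <= ereal_inf S)%E.
  apply: le_ereal_inf_tmp => _ [xi [Kxi _] <-]; rewrite lee_fin addr_ge0//.
  by rewrite (le_trans (ltW l0_gt0))// l_ge.
have Sfin : (ereal_inf S < +oo)%E.
  have [xi Kxi Dxi] := KD x.
  apply: (@le_lt_trans _ _ (h (x + xi) + l T x xi)%:E); last exact: ltry.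
  by apply: ereal_inf_lbound; exists xi.
have mE : ereal_inf S = (fine (ereal_inf S))%:E by rewrite fineK// ge0_fin_numE.
set m := fine _ in mE.
have ex k : exists xi, [/\ K xi, closure D (x + xi) &
    h (x + xi) + l T x xi <= m + k.+1%:R^-1].
  have /ereal_inf_lt[_ [xi [Kxi Dxi] <-]] : (ereal_inf S < (m + k.+1%:R^-1)%:E)%E.
    by rewrite mE lte_fin lt_add_harmonic.
  by rewrite lte_fin => /ltW hm; exists xi.
pose xi_ k := sval (cid (ex k)).
have KV k : [/\ K (xi_ k), closure D (x + xi_ k) &
    h (x + xi_ k) + l T x (xi_ k) <= m + k.+1%:R^-1].
  exact: (svalP (cid (ex k))).
have [rho rhoP] := l_coercive (m + 1).
have [Fl FU sub] := ultra_oo.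
have FP := @ultra_proper _ _ FU.
have xrho : \forall k \near Fl, [set y : 'rV[R]_n | `|y| <= rho] (xi_ k).
  apply: nearW => k /=; have [Kk _ hk] := KV k; apply: (rhoP T x _ TT Kk).
  apply: (@le_trans _ _ (h (x + xi_ k) + l T x (xi_ k))); first by rewrite lerDr.
  by rewrite (le_trans hk)// lerD2l invf_le1// ler1n.
have [xi _ xic] := compact_ultra_cvg FU (@closed_ball0_compact R n rho) xrho.
have Kxi : K xi.
  by apply: closed_cvg K_closed _ _ xic; apply: nearW => k; have [] := KV k.
have xxic : x + xi_ k @[k --> Fl] --> x + xi by apply: cvgD => //; exact: cvg_cst.
have Dxi : closure D (x + xi).
  apply: closed_cvg (@closed_closure _ D) _ _ xxic.
  by apply: nearW => k; have [] := KV k.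
have lc : l T x (xi_ k) @[k --> Fl] --> l T x xi.
  apply: (@impulse_cost_cvg _ Fl FP (fun=> T) (fun=> x)) => //.
  - exact: nearW.
  - by apply: nearW => k; have [] := KV k.
  - exact: cvg_cst.
  - exact: cvg_cst.
have hc : h (x + xi_ k) @[k --> Fl] --> h (x + xi) by exact: cvg_comp xxic (@h_cont _).
exists xi => //; apply/eqP; rewrite eq_le; apply/andP; split; last first.
  by apply: ereal_inf_lbound; exists xi.
rewrite mE lee_fin; apply: (le_cvgr (cvgD hc lc) (sub _ _ _ (@cvg_add_harmonic m))).
by apply: nearW => k; have [] := KV k.
Qed.

Lemma merge_terminal p u x : is_control K T T (p :: u) -> exists xi,
  [/\ K xi, endpoint T x (p :: u) = x + xi &
    h (x + xi) + l T x xi <= payoff T x (p :: u)].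
Proof.
elim: u p x => [|q u IH] [tau xi] x.
  move=> /is_control_cons[/= /le_anti <- Kxi _]; exists xi; split=> //.
    by rewrite !free_id.
  by rewrite !running_le// !free_id// !add0r addrC.
move=> /is_control_cons[+ Kxi cu] => /le_anti tE; rewrite /= in tE Kxi cu; subst tau.
have [xi' [Kxi' Exi' pxi']] := IH q (x + xi) cu.
exists (xi + xi'); split; first exact: K_D.
  by rewrite -[LHS]/(endpoint T (free T x T + xi) (q :: u)) free_id// Exi' addrA.
rewrite payoff_first// addrA; apply: le_trans (_ : _ <= _) _; last first.
  by apply: lerD (lexx (l T x xi)) pxi'.
by rewrite addrCA lerD2l; exact: l_sub.
Qed.

Lemma value_terminal x : V T x = hD K D l T h x.
Proof.
have TT : 0 <= T <= T by rewrite T_ge0 lexx.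
have ND : (V T x <= ND_op K D l T h x)%E.
  apply: le_ereal_inf_tmp => _ [xi [Kxi Dxi] <-].
  have -> : h (x + xi) + l T x xi = payoff T x [:: (T, xi)].
    by rewrite payoff_first//= running_le// free_id// add0r addrC.
  apply: value_le_payoff => //.
    by apply/is_control_cons; rewrite /= lexx; split=> //; exact: is_control_nil.
  by rewrite /= !free_id.
have NDle p u : is_control K T T (p :: u) -> closure D (endpoint T x (p :: u)) ->
    (ND_op K D l T h x <= (payoff T x (p :: u))%:E)%E.
  move=> /(merge_terminal x)[xi [Kxi -> pxi]] Dxi.
  apply: (@le_trans _ _ (h (x + xi) + l T x xi)%:E); last by rewrite lee_fin.
  by apply: ereal_inf_lbound; exists xi.
have nil : payoff T x [::] = h x by rewrite /= running_le// free_id// add0r.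
rewrite /hD; case: ifPn => [/asboolP Dx|/asboolPn Dx]; apply/eqP; rewrite eq_le;
  apply/andP; split => //.
- rewrite le_min ND andbT -nil; apply: value_le_payoff => //.
  by rewrite /= free_id.
- apply: le_ereal_inf_tmp => _ [u /admissibleP[]// cu Du <-]; rewrite costE//.
  case: u cu Du => [|p u] cu Du; rewrite ge_min; first by rewrite nil lexx.
  by rewrite NDle// orbT.
- apply: le_ereal_inf_tmp => _ [u /admissibleP[]// cu Du <-]; rewrite costE//.
  case: u cu Du => [|p u] cu Du; last exact: NDle.
  by move: Du; rewrite /= free_id.
Qed.

Lemma value_le_free t th x : 0 <= t -> t <= th -> th <= T ->
  (V t x <= (running t x th)%:E + V th (free t x th))%E.
Proof.
move=> t0 tth thT; have th0 := le_trans t0 tth; have tT := le_trans tth thT.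
have [Vfin|] := ltP (V th (free t x th)) +oo%E; last first.
  by rewrite leye_eq => /eqP ->; rewrite addey// leey.
have [u [cu Du ->]] := value_attained th0 thT Vfin.
rewrite -EFinD -payoff_shift//; apply: value_le_payoff => //.
  exact: is_control_le cu.
by rewrite (endpoint_shift _ tth).
Qed.

Lemma value_free_continuation t x : 0 <= t -> t < T ->
  (V t x < N_op K l V t x)%E ->
  exists tb, t < tb <= T /\ forall th, t <= th < tb ->
    V t x = ((running t x th)%:E + V th (free t x th))%E.
Proof.
move=> t0 tT VN; have tT' := ltW tT.
have [u [cu Du Vu]] := value_attained t0 tT' (lt_le_trans VN (leey _)).
suff [tb [ttb tbT ctb]] : exists tb, [/\ t < tb, tb <= T &
    forall th, t <= th < tb -> is_control K T th u].
  exists tb; rewrite ttb tbT; split=> // th /[dup] thb /andP[tth thtb].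
  have thT : th <= T := ltW (lt_le_trans thtb tbT).
  have cth := ctb _ thb.
  apply/eqP; rewrite eq_le value_le_free//=.
  rewrite Vu (payoff_shift x t0 tth thT cth) EFinD leeD2l//.
  apply: value_le_payoff => //; first exact: le_trans tth.
  by rewrite -endpoint_shift.
case: u cu Du Vu => [|[tau xi] u] cu Du Vu.
  by exists T; split=> // th _; exact: is_control_nil.
have [/= /andP[ttau tauT] Kxi cu'] := (is_control_cons _ _ _ _ _).1 cu.
exists tau; split=> //; last first.
  move=> th /andP[_ thtau]; apply/is_control_cons; split=> //=.
  by rewrite (ltW thtau).
rewrite lt_neqAle ttau andbT; apply/eqP => tE; subst tau.
move: VN; rewrite ltNge => /negP; apply.
rewrite Vu payoff_first// EFinD addeC.
apply: (@le_trans _ _ (V t (x + xi) + (l t x xi)%:E)%E).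
  by apply: ereal_inf_lbound; exists xi.
rewrite leeD2r//; apply: value_le_payoff => //.
by move: Du; rewrite /= free_id.
Qed.

End ImpulseControl.

Section Euclidean.
Variables (R : realType) (n : nat).
Implicit Types (x y xi : 'rV[R]_n).

Lemma enorm_ge0 x : 0 <= enorm x.
Proof. exact: sqrtr_ge0. Qed.

Lemma mx_norm_le_enorm x : `|x| <= enorm x.
Proof.
rewrite mx_norm_le ?enorm_ge0//; apply/forallP => i; rewrite -sqrtr_sqr.
apply: ler_wsqrtr; rewrite (bigD1 i)//= lerDl.
by apply: sumr_ge0 => j _; exact: sqr_ge0.
Qed.

Lemma enorm_le_mx_norm x : enorm x <= Num.sqrt n%:R * `|x|.
Proof.
rewrite -[X in _ * X]ger0_norm// -sqrtr_sqr -sqrtrM//; apply: ler_wsqrtr.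
have -> : n%:R * `|x| ^+ 2 = \sum_(i < n) `|x| ^+ 2.
  by rewrite sumr_const card_ord mulr_natl.
apply: ler_sum => i _.
by rewrite -real_normK ?num_real// ler_sqr ?nnegrE// coord_le_mx_norm.
Qed.

Lemma holder_modulus (C mu delta M e : R) : 0 < C -> 0 <= mu -> 0 < delta ->
  0 < e -> exists2 d, 0 < d & forall x y, `|x| <= M -> `|y| <= M ->
    `|x - y| <= d ->
    C * (1 + Num.max (enorm x `^ mu) (enorm y `^ mu)) * enorm (x - y) `^ delta
      <= e.
Proof.
move=> C0 mu0 delta0 e0; pose N : R := Num.sqrt n%:R.
have N0 : 0 <= N by exact: sqrtr_ge0.
pose A := C * (1 + (N * M) `^ mu).
have A0 : 0 < A by rewrite mulr_gt0// ltr_wpDr// powR_ge0.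
have dE0 : 0 < (e / A) `^ delta^-1 by apply: powR_gt0; exact: divr_gt0.
exists ((e / A) `^ delta^-1 / (N + 1)).
  by rewrite divr_gt0// ltr_wpDl.
move=> x y xM yM xy.
have bound (z : 'rV[R]_n) : `|z| <= M -> enorm z `^ mu <= (N * M) `^ mu.
  move=> zM; have zN : enorm z <= N * M.
    by rewrite (le_trans (enorm_le_mx_norm z))// ler_wpM2l.
  by apply: ge0_ler_powR; rewrite ?nnegrE ?enorm_ge0// (le_trans (enorm_ge0 z)).
have -> : e = A * (e / A) by rewrite mulrCA divff ?mulr1// gt_eqF.
apply: ler_pM; rewrite ?powR_ge0//.
- by rewrite mulr_ge0 ?(ltW C0)// addr_ge0// le_max powR_ge0.
- by rewrite ler_wpM2l ?(ltW C0)// lerD2l ge_max !bound.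
rewrite -[leRHS](@powRr1 _ (e / A)) ?divr_ge0 ?(ltW e0) ?(ltW A0)//.
rewrite -(mulVf (lt0r_neq0 delta0)) powRrM.
apply: ge0_ler_powR; rewrite ?nnegrE ?enorm_ge0 ?powR_ge0 ?(ltW delta0)//.
apply: (le_trans (enorm_le_mx_norm _)); rewrite ler_pdivlMr ?ltr_wpDl// in xy.
by rewrite (le_trans _ xy)// mulrC ler_wpM2l// lerDl.
Qed.

Lemma powR_coercive (a beta b M : R) : 0 < a -> 0 < beta -> 0 <= b ->
  exists rho, forall xi, b + a * enorm xi `^ beta <= M -> `|xi| <= rho.
Proof.
move=> a0 beta0 b0; exists ((M / a) `^ beta^-1) => xi xiM.
apply: (le_trans (mx_norm_le_enorm xi)).
rewrite -[leLHS](@powRr1 _ (enorm xi)) ?enorm_ge0//.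
rewrite -(mulfV (lt0r_neq0 beta0)) powRrM.
have xiMa : enorm xi `^ beta <= M / a.
  by rewrite ler_pdivlMr// mulrC (le_trans _ xiM)// lerDr.
apply: ge0_ler_powR; rewrite ?nnegrE ?powR_ge0 ?invr_ge0 ?(ltW beta0)//.
by rewrite (le_trans _ xiMa)// powR_ge0.
Qed.

Lemma closed_cone_0 (K : set 'rV[R]_n) : closed K -> conic K -> K !=set0 -> K 0.
Proof.
move=> cK coK [xi Kxi].
have c0 : k.+1%:R^-1 *: xi @[k --> \oo] --> (0 : 'rV[R]_n).
  by rewrite -(scale0r xi); apply: cvgZr_tmp; exact: cvg_harmonic.
apply: closed_cvg cK _ _ c0; apply: nearW => k.
by apply: coK => //; rewrite invr_gt0.
Qed.

Lemma convex_coneD (K : set 'rV[R]_n) xi xi' : convex_set K -> conic K ->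
  K xi -> K xi' -> K (xi + xi').
Proof.
move=> vK cK Kxi Kxi'.
have h0 : 0 <= 2^-1 :> R by rewrite invr_ge0.
have h1 : 2^-1 <= 1 :> R by rewrite invf_le1// ler1n.
have := vK xi xi' (Itv01 h0 h1) (mem_set Kxi) (mem_set Kxi').
rewrite inE => /(cK _ 2)/(_ (ltr0n _ 2)).
rewrite /conv/= scalerDr !scalerA.
rewrite divff// [X in X *: xi'](_ : _ = 1) ?scale1r//.
by rewrite /unstable.onem; field.
Qed.

End Euclidean.

Theorem theorem4p1 (R : realType) (n : nat) (T : R)
    (K D : set 'rV[R]_n)
    (f : R -> 'rV[R]_n -> 'rV[R]_n)
    (g : R -> 'rV[R]_n -> R) (h : 'rV[R]_n -> R)
    (l : R -> 'rV[R]_n -> 'rV[R]_n -> R)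
    (Lf L mu delta l0 delta0 beta : R) (alpha0 alpha : R -> R)
    (n_ge1 : (1 <= n)%N) (T_gt0 : 0 < T)
    (* (1) *)
    (K_closed : closed K) (K_convex : convex_set K) (K_cone : conic K)
    (D_neq0 : D !=set0) (D_convex : convex_set D)
    (D_open : open D) (D_connected : connected D) (D_neqT : D <> setT)
    (KD : (bounded_set D /\ K = setT) \/
          (conic D /\ [set eta - xi | eta in D & xi in K] = setT))
    (* (2) *)
    (f_cont : {within `[0, T] `*` [set: 'rV[R]_n],
                continuous (fun p : R * 'rV[R]_n => f p.1 p.2)})
    (Lf_gt0 : 0 < Lf)
    (f_lip : forall (t : R) (x x' : 'rV[R]_n), 0 <= t <= T ->
       enorm (f t x - f t x') <= Lf * enorm (x - x'))
    (f_bnd : forall t : R, 0 <= t <= T -> enorm (f t 0) <= Lf)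
    (* (3) *)
    (g_cont : {within `[0, T] `*` [set: 'rV[R]_n],
                continuous (fun p : R * 'rV[R]_n => g p.1 p.2)})
    (h_cont : continuous h)
    (L_gt0 : 0 < L) (mu_gt0 : 0 < mu) (delta_itv : 0 < delta <= 1)
    (g_bnd : forall (t : R) (x : 'rV[R]_n), 0 <= t <= T ->
       0 <= g t x <= L * (1 + enorm x `^ (mu + delta)))
    (h_bnd : forall x : 'rV[R]_n, 0 <= h x <= L * (1 + enorm x `^ (mu + delta)))
    (g_hol : forall (t : R) (x x' : 'rV[R]_n), 0 <= t <= T ->
       `|g t x - g t x'| <=
       L * (1 + Num.max (enorm x `^ mu) (enorm x' `^ mu))
         * enorm (x - x') `^ delta)
    (h_hol : forall x x' : 'rV[R]_n,
       `|h x - h x'| <=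
       L * (1 + Num.max (enorm x `^ mu) (enorm x' `^ mu))
         * enorm (x - x') `^ delta)
    (* (4) *)
    (l_gt0 : forall (t : R) (x xi : 'rV[R]_n), 0 <= t <= T -> K xi -> 0 < l t x xi)
    (l_cont : {within `[0, T] `*` [set: 'rV[R]_n] `*` K,
                continuous (fun p : R * 'rV[R]_n * 'rV[R]_n =>
                              l p.1.1 p.1.2 p.2)})
    (l0_gt0 : 0 < l0) (delta0_gt0 : 0 < delta0) (beta_itv : 0 < beta <= 1)
    (alpha0_gt0 : forall t : R, 0 <= t <= T -> 0 < alpha0 t)
    (alpha_gt0 : forall t : R, 0 <= t <= T -> 0 < alpha t)
    (alpha0_cont : {within `[0, T], continuous alpha0})
    (alpha_cont : {within `[0, T], continuous alpha})
    (alpha0_dec : forall t t' : R, 0 <= t -> t <= t' -> t' <= T ->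
       alpha0 t' <= alpha0 t)
    (alpha_dec : forall t t' : R, 0 <= t -> t <= t' -> t' <= T ->
       alpha t' <= alpha t)
    (l_bnd : forall (t : R) (x xi : 'rV[R]_n), 0 <= t <= T -> K xi ->
       l0 + alpha0 t * enorm xi `^ beta <= l t x xi
         <= L + alpha t * enorm xi `^ beta)
    (l_hol : forall (t : R) (x x' xi : 'rV[R]_n), 0 <= t <= T -> K xi ->
       `|l t x xi - l t x' xi| <=
       L * (1 + Num.max (enorm x `^ mu) (enorm x' `^ mu))
         * enorm (x - x') `^ delta)
    (l_sub : forall (t : R) (x xi xi' : 'rV[R]_n), 0 <= t <= T -> K xi -> K xi' ->
       delta0 <= Num.min (l t x xi + l t (x + xi) xi')
                         (l t x xi' + l t (x + xi') xi)
                 - l t x (xi + xi'))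
    (l_mono : forall (t t' : R) (x xi : 'rV[R]_n), 0 <= t -> t <= t' -> t' <= T -> K xi ->
       l t x xi - L * `|t - t'| <= l t' x xi <= l t x xi)
    (* (5) *)
    (h_exit : forall x : 'rV[R]_n, ~ D x ->
       (ereal_inf [set (h (x + xi) + l T x xi)%R%:E
                    | xi in [set xi | K xi /\ D (x + xi)%R]]
        < (h x)%:E)%E) :
  let V := value K D f g h l T in
  let X0 (t : R) (x : 'rV[R]_n) := trajectory f T t x [::] in
  [/\ (* (i) *)
      forall (t : R) (x : 'rV[R]_n), 0 <= t < T ->
        attains_inf (N_values K l V t x) /\ (V t x <= N_op K l V t x)%E,
      (* (ii) *)
      forall (t th : R) (x : 'rV[R]_n), 0 <= t -> t <= th -> th <= T ->
        (V t x <= \int[@lebesgue_measure R]_(r in `[t, th]) (g r (X0 t x r))%:E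
                  + V th (X0 t x th))%E,
      (* (iii) *)
      forall (t : R) (x : 'rV[R]_n), 0 <= t < T -> (V t x < N_op K l V t x)%E ->
        exists tb : R, t < tb <= T /\
          forall th : R, t <= th < tb ->
            V t x = (\int[@lebesgue_measure R]_(r in `[t, th])
                       (g r (X0 t x r))%:E
                     + V th (X0 t x th))%E &
      (* (iv) *)
      forall x : 'rV[R]_n,
        attains_inf (ND_values K D l T h x) /\ V T x = hD K D l T h x].
Proof.
move=> V X0.
have T_ge0 := ltW T_gt0.
pose C : R := Num.sqrt n%:R.
have C_gt0 : 0 < C by rewrite sqrtr_gt0 ltr0n.
have L'_gt0 : 0 < Lf * C by exact: mulr_gt0.
have f_lip' r x y : 0 <= r <= T -> `|f r x - f r y| <= Lf * C * `|x - y|.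
  move=> rT; rewrite (le_trans (mx_norm_le_enorm _))// (le_trans (f_lip _ _ _ rT))//.
  by rewrite -mulrA ler_pM2l// enorm_le_mx_norm.
have f_bnd' r : 0 <= r <= T -> `|f r 0| <= Lf.
  by move=> rT; rewrite (le_trans (mx_norm_le_enorm _))// f_bnd.
have g_ge0 r x : 0 <= r <= T -> 0 <= g r x by move=> /(g_bnd r x)/andP[].
have [delta_gt0 _] := andP delta_itv.
have [beta_gt0 _] := andP beta_itv.
have g_unif (M e : R) : 0 < e -> exists2 d, 0 < d & forall r x y,
    0 <= r <= T -> `|x| <= M -> `|y| <= M -> `|x - y| <= d ->
    `|g r x - g r y| <= e.
  move=> e0; have [d d0 dP] := holder_modulus n M L_gt0 (ltW mu_gt0) delta_gt0 e0.
  exists d => // r x y rT xM yM xy.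
  exact: le_trans (g_hol r x y rT) (dP _ _ xM yM xy).
have h_ge0 x : 0 <= h x by case/andP: (h_bnd x).
have TT : 0 <= T <= T by rewrite T_ge0 lexx.
have l_lower t x xi : 0 <= t <= T -> K xi ->
    l0 + alpha0 T * enorm xi `^ beta <= l t x xi.
  move=> tT Kxi; have [t0 tT'] := andP tT.
  have /andP[+ _] := l_bnd t x xi tT Kxi; apply: le_trans.
  by rewrite lerD2l ler_wpM2r ?powR_ge0// alpha0_dec.
have l_ge t x xi : 0 <= t <= T -> K xi -> l0 <= l t x xi.
  move=> tT Kxi; rewrite (le_trans _ (l_lower t x xi tT Kxi))// lerDl.
  by rewrite mulr_ge0 ?powR_ge0// ltW// alpha0_gt0.
have l_coercive (M : R) : exists rho : R, forall t x xi, 0 <= t <= T -> K xi ->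
    l t x xi <= M -> `|xi| <= rho.
  have [rho rhoP] := powR_coercive n M (alpha0_gt0 T TT) beta_gt0 (ltW l0_gt0).
  exists rho => t x xi tT Kxi lM; apply: rhoP.
  exact: le_trans (l_lower t x xi tT Kxi) lM.
have K_neq0 : K !=set0.
  case: KD => [[_ ->]|[_ DK]]; first by exists 0.
  have : [set eta - xi | eta in D & xi in K] (0 : 'rV[R]_n) by rewrite DK.
  by move=> [eta _ [xi Kxi _]]; exists xi.
have K_0 : K 0 by exact: closed_cone_0.
have K_D xi xi' : K xi -> K xi' -> K (xi + xi') by exact: convex_coneD.
have l_sub' x xi xi' : K xi -> K xi' ->
    l T x (xi + xi') <= l T x xi + l T (x + xi) xi'.
  move=> Kxi Kxi'; rewrite -subr_ge0.
  have := l_sub T x xi xi' TT Kxi Kxi'; rewrite lerBrDr le_min => /andP[+ _].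
  by rewrite subr_ge0; apply: le_trans; rewrite lerDr ltW.
have reach x : exists2 xi, K xi & closure D (x + xi).
  case: KD => [[_ ->]|[_ DK]].
    have [y Dy] := D_neq0; exists (y - x) => //.
    by rewrite addrC subrK; exact: subset_closure.
  have [eta De [xi Kxi exi]] : [set eta - xi | eta in D & xi in K] x by rewrite DK.
  by exists xi => //; rewrite -exi subrK; exact: subset_closure.
have X0E t th x : 0 <= t -> t <= th -> th <= T -> X0 t x th = free T f t x th.
  move=> t0 tth thT.
  by rewrite /X0 (trajectory_nil K T_ge0 f_cont L'_gt0 f_lip' f_bnd')// tth.
have runE t th x : 0 <= t -> th <= T ->
    (\int[@lebesgue_measure R]_(r in `[t, th]) (g r (X0 t x r))%:E)%E
    = (running T f g t x th)%:E.
  move=> t0 thT.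
  exact: (integral_trajectory_nil K T_ge0 f_cont L'_gt0 f_lip' f_bnd' g_cont).
split.
- move=> t x /andP[t0 /ltW tT]; split.
    exact: (N_attained T_ge0 f_cont L'_gt0 f_lip' f_bnd' g_cont g_ge0
      g_unif h_ge0 h_cont K_closed l_cont l0_gt0 l_ge l_coercive).
  apply: le_ereal_inf_tmp => _ [xi Kxi <-].
  exact: (value_le_impulse T_ge0 f_cont L'_gt0 f_lip' f_bnd' g_cont g_ge0
    g_unif h_ge0 h_cont K_closed l_cont l0_gt0 l_ge l_coercive).
- move=> t th x t0 tth thT; rewrite runE// X0E//.
  exact: (value_le_free T_ge0 f_cont L'_gt0 f_lip' f_bnd' g_cont g_ge0
    g_unif h_ge0 h_cont K_closed l_cont l0_gt0 l_ge l_coercive).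
- move=> t x /andP[t0 tT] VN.
  have [tb [/andP[ttb tbT] tbP]] : exists tb, t < tb <= T /\
      forall th, t <= th < tb ->
      V t x = ((running T f g t x th)%:E + V th (free T f t x th))%E.
    exact: (value_free_continuation T_ge0 f_cont L'_gt0 f_lip' f_bnd' g_cont
      g_ge0 g_unif h_ge0 h_cont K_closed l_cont l0_gt0 l_ge l_coercive).
  exists tb; split; first by apply/andP.
  move=> th thb; have [tth thtb] := andP thb.
  have thT := ltW (lt_le_trans thtb tbT).
  by rewrite (runE t th x t0 thT) (X0E t th x t0 tth thT); exact: tbP.
- move=> x; split.
    exact: (ND_attained T_ge0 h_ge0 h_cont K_closed l_cont l0_gt0 l_ge l_coercive).
  exact: (value_terminal T_ge0 f_cont L'_gt0 f_lip' f_bnd').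
Qed.
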